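(* Let $r>1$. Then the critical point $\mathbf{h}^{2r}$ of the energy $E_4$ is unstable, in the following sense: for every neighborhood $U$ of $\mathbf{h}^{2r}$ in the metric space $(\mathcal{M}_4,d)$ there exists $\mathbf{n}\in U$ such that $E_4[\mathbf{n}]-E_4[\mathbf{h}^{2r}]<0$.
   Context: Write $\mathbf{e}_3=(0,0,1)$ and let $\mathbb{S}^2\subset\mathbb{R}^3$ be the unit sphere. For $\mathbf{n}=(n_1,n_2,n_3):\mathbb{R}^2\to\mathbb{R}^3$ set $\nabla\times\mathbf{n}:=(\partial_1,\partial_2,0)\times\mathbf{n}=(\partial_2 n_3,\,-\partial_1 n_3,\,\partial_1 n_2-\partial_2 n_1)$. For $r>0$ and $\mathbf{n}:\mathbb{R}^2\to\mathbb{S}^2$ define $$E_4[\mathbf{n}]=D[\mathbf{n}]+rH[\mathbf{n}]+V_4[\mathbf{n}],$$ $$D[\mathbf{n}]=\frac12\int_{\mathbb{R}^2}|\nabla\mathbf{n}|^2dx,\quad H[\mathbf{n}]=\int_{\mathbb{R}^2}(\mathbf{n}-\mathbf{e}_3)\cdot(\nabla\times\mathbf{n})\,dx,\quad V_4[\mathbf{n}]=\frac18\int_{\mathbb{R}^2}|\mathbf{n}-\mathbf{e}_3|^4dx=\frac12\int_{\mathbb{R}^2}(1-n_3)^2dx.$$ Let $\mathcal{M}_4:=\{\mathbf{n}:\mathbb{R}^2\to\mathbb{S}^2 : D[\mathbf{n}]+V_4[\mathbf{n}]<\infty\}$ with the metric $d(\mathbf{n},\mathbf{m}):=\|\mathbf{n}-\mathbf{m}\|_{L^4(\mathbb{R}^2)}+\|\nabla(\mathbf{n}-\mathbf{m})\|_{L^2(\mathbb{R}^2)}$.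 The functional $E_4$ is well defined on $\mathcal{M}_4$. Define $\mathbf{h}^{2r}(x):=\mathbf{h}\left(\frac{x}{2r}\right)$, where $$\mathbf{h}(x):=\left(\frac{-2x_2}{1+|x|^2},\ \frac{2x_1}{1+|x|^2},\ -\frac{1-|x|^2}{1+|x|^2}\right).$$ Then $\mathbf{h}^{2r}\in\mathcal{M}_4$, and it solves the Euler–Lagrange equation of $E_4$, namely $-\Delta\mathbf{n}+2r\nabla\times\mathbf{n}-(1-n_3)\mathbf{e}_3-\Lambda(\mathbf{n})\mathbf{n}=0$ with $\Lambda(\mathbf{n})=|\nabla\mathbf{n}|^2+2r\,\mathbf{n}\cdot(\nabla\times\mathbf{n})-(1-n_3)n_3$. *)

(* Defs.v *)
From HB Require Import structures.
From mathcomp Require Import all_boot all_order all_algebra.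
From mathcomp Require Import all_classical all_reals all_analysis.

Set Implicit Arguments.
Unset Strict Implicit.
Unset Printing Implicit Defensive.
Import Order.TTheory GRing.Theory Num.Theory.
Import numFieldNormedType.Exports.

Local Open Scope classical_set_scope.
Local Open Scope ring_scope.

Section plane.
Context {R : realType}.
Implicit Types (u g phi : R * R -> R) (j : 'I_2) (x : R * R).

Definition leb2 : {measure set (measurableTypeR R * measurableTypeR R) -> \bar R} :=
  (@lebesgue_measure R \x @lebesgue_measure R)%E.

Definition basis2 j : R * R := if j == 0 then (1, 0) else (0, 1).

Definition partial j u : R * R -> R := fun x => 'D_(basis2 j) u x.

Fixpoint is_Ck (k : nat) u : Prop :=
  continuous u /\
  (if k is k'.+1 then
     forall j, (forall x, derivable u x (basis2 j)) /\ is_Ck k' (partial j u)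
   else True).

Definition is_test_fun phi :=
  (forall k, is_Ck k phi) /\ compact (closure [set x | phi x != 0]).

Definition loc_integrable u :=
  measurable_fun [set: measurableTypeR R * measurableTypeR R] u /\
  forall K : set (R * R), compact K -> leb2.-integrable K (EFin \o u).

Definition is_weak_partial j u g :=
  [/\ loc_integrable u, loc_integrable g &
      forall phi, is_test_fun phi ->
        (\int[leb2]_x (u x * partial j phi x)%:E =
         - \int[leb2]_x (g x * phi x)%:E)%E].

Definition weakly_differentiable u :=
  forall j, exists g, is_weak_partial j u g.

(* A representative, unique up to null sets, of the weak derivative; it is only
   meaningful when u is weakly differentiable. *)
Definition weak_partial j u : R * R -> R :=
  xget (cst 0) [set g | is_weak_partial j u g].

End plane.

Section energy.
Context {R : realType}.
Implicit Types (v w : 'rV[R]_3) (n m : R * R -> 'rV[R]_3) (x : R * R) (r : R).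

Definition vec3 (a b c : R) : 'rV[R]_3 := \row_(i < 3) [:: a; b; c]`_i.

Definition e3 : 'rV[R]_3 := vec3 0 0 1.

Definition dot v w : R := \sum_(i < 3) v 0 i * w 0 i.

(* The norm of the normedModType 'rV[R]_3 is the sup norm. *)
Definition enorm v : R := Num.sqrt (dot v v).

Definition component n (i : 'I_3) : R * R -> R := fun x => n x 0 i.

Definition wd n (j : 'I_2) (i : 'I_3) : R * R -> R := weak_partial j (component n i).

Definition grad_norm n x : R :=
  Num.sqrt (\sum_(j < 2) \sum_(i < 3) wd n j i x ^+ 2).

Definition curl n x : 'rV[R]_3 :=
  vec3 (wd n 1 2 x) (- wd n 0 2 x) (wd n 0 1 x - wd n 1 0 x).

Local Open Scope ereal_scope.

Definition Dirichlet n : \bar R := 2^-1%:E * \int[leb2]_x (grad_norm n x ^+ 2)%:E.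

Definition helicity n : \bar R := \int[leb2]_x (dot (n x - e3) (curl n x))%:E.

Definition V4 n : \bar R := 8^-1%:E * \int[leb2]_x (enorm (n x - e3) ^+ 4)%:E.

Definition E4 r n : \bar R := Dirichlet n + r%:E * helicity n + V4 n.

(* Finiteness of the Dirichlet energy presupposes that the weak gradient
   exists, which has to be said since weak_partial is total. *)
Definition M4 : set (R * R -> 'rV[R]_3) :=
  [set n | [/\ forall x, enorm (n x) = 1%R,
               forall i, weakly_differentiable (component n i) &
               Dirichlet n + V4 n < +oo]].

Definition dist4 n m : \bar R :=
  'N[leb2]_4%:E[EFin \o (fun x => enorm (n x - m x))] +
  'N[leb2]_2%:E[EFin \o grad_norm (fun x => n x - m x)%R].

Definition M4_neighborhood n (U : set (R * R -> 'rV[R]_3)) :=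
  U `<=` M4 /\
  exists2 eps : R, (0 < eps)%R & forall m, M4 m -> dist4 m n < eps%:E -> U m.

End energy.

Section skyrmion.
Context {R : realType}.

Definition hmap (x : R * R) : 'rV[R]_3 :=
  let s := x.1 ^+ 2 + x.2 ^+ 2 in
  vec3 (- 2 * x.2 / (1 + s)) (2 * x.1 / (1 + s)) (- ((1 - s) / (1 + s))).

Definition hscaled (lambda : R) (x : R * R) : 'rV[R]_3 :=
  hmap (x.1 / lambda, x.2 / lambda).

End skyrmion.

(* Main.v *)
Require Import Defs.
From mathcomp Require Import all_boot all_order all_algebra.
From mathcomp Require Import all_classical all_reals all_analysis.
From mathcomp Require Import measurable_realfun ring lra.

Set Implicit Arguments.
Unset Strict Implicit.
Unset Printing Implicit Defensive.
Import Order.TTheory GRing.Theory Num.Theory.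
Import numFieldNormedType.Exports.

Local Open Scope classical_set_scope.
Local Open Scope ring_scope.

(** The skyrmion h^(2r) is unstable because it loses energy when its first
    coordinate is multiplied by 1 + e and its second one by 1 - e, however small
    e > 0 is, as soon as r > 1.

    Put n_(a,b)(x) = h(a x_1, b x_2) and q = 1 / (1 + a^2 x_1^2 + b^2 x_2^2), so
    that h^(2r) = n_(l,l) with l = 1/(2r).  The three energy densities of n_(a,b)
    are pointwise multiples of one function:
      |grad n|^2 = 4 (a^2 + b^2) q^2,   (n - e_3) . curl n = - 4 (a + b) q^2,
      |n - e_3|^4 = 16 q^2
    [sum_dsk, dot_curl_sk, enorm4_sk].  Since the integral of q^2 is J / (a b),
    with 0 < J < oo independent of a and b [integral_skyrmion_density],
      E_4[n_(a,b)] = (2 (a^2 + b^2) - 4 r (a + b) + 2) J / (a b).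
    For a = (1 + e) l and b = (1 - e) l this gives
      E_4[n_(a,b)] - E_4[h^(2r)] = - 8 e^2 (r^2 - 1) J / (1 - e^2) < 0
    [E4_sk_lt].  Behind this computation: after rescaling space by 2r, the energy
    becomes D + 4 r^2 (H/2 + V_4), and the stereographic coordinate
    (n_1 + i n_2) / (1 - n_3) of n_(a,b) becomes z + e conj(z) up to a constant
    factor.  At r = 1 all these maps solve the same first-order Bogomolny equation
    and have the same energy.  Increasing r amplifies the part H/2 + V_4, which is
    smaller on n_(a,b) than on h exactly because D is larger there.

    The distance of n_(a,b) to h^(2r) tends to 0 with e by dominated convergence,
    all the integrands being bounded by a multiple of q^2 taken at a = b = l/2
    [dist4_sk_small].

    The energy is built on weak derivatives, of which only some representative is
    given.  The computation is therefore legitimate only after two facts on the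
    plane.  A continuously differentiable function has its classical partial
    derivatives as weak ones [C1_weak_partial], by Fubini and the fundamental
    theorem of calculus.  Two weak derivatives agree almost everywhere
    [weak_partial_unique]: a locally integrable g orthogonal to all test
    functions has integral 0 on every bounded open rectangle, because the
    indicator of a rectangle is a pointwise limit of test functions, and open
    rectangles generate the product sigma-algebra [du_bois_reymond]. *)

(** * Measurability on the plane *)

(** The product sigma-algebra is generated by measurable rectangles, not by open
    sets: the two agree because the plane is second countable, every open set
    being the union of the products of intervals with rational centres and radius
    1/(n+1) that it contains. *)
Lemma open_plane_measurable {R : realType} (A : set (R * R)) :
  open A -> measurable (A : set (measurableTypeR R * measurableTypeR R)).
Proof.
move=> oA.
pose rect (p : rat * rat * nat) : set (R * R) :=
  ball (ratr p.1.1 : R) (p.2.+1%:R^-1) `*` ball (ratr p.1.2 : R) (p.2.+1%:R^-1).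
pose F p := if `[< rect p `<=` A >] then rect p else set0.
have -> : A = \bigcup_p F p.
  apply/seteqP; split=> [[x y] Axy|z [p _]]; last first.
    by rewrite /F; case: asboolP => [sA|_ []]; exact: sA.
  have /nbhs_ballP[e /= e0 eA] : nbhs (x, y) A by exact: open_nbhs_nbhs.
  have [n n2e] : exists n, n.+1%:R^-1 + n.+1%:R^-1 < e :> R.
    have e2 : 0 < e / 2 by rewrite divr_gt0.
    have [N _ /(_ N (leqnn _)) NE] := near_infty_natSinv_lt (PosNum e2).
    by exists N; rewrite [ltRHS](splitr e) ltrD.
  have n0 : 0 < n.+1%:R^-1 :> R by rewrite invr_gt0.
  pose d : R := n.+1%:R^-1; rewrite -/d in n0 n2e.
  have near_rat (u : R) : exists q : rat, ball (ratr q : R) d u.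
    have [|q] := @rat_in_itvoo R (u - d) (u + d); first by lra.
    rewrite in_itv/= => /andP[? ?]; exists q.
    by rewrite -ball_normE/= ltr_norml; apply/andP; split; lra.
  have [p px] := near_rat x; have [q qy] := near_rat y.
  exists (p, q, n) => //; rewrite /F; case: asboolP => //= -[] [u v] [/= pu qv].
  apply: eA; split => /=; apply: (le_ball (ltW n2e)).
    by apply: ball_triangle pu; exact: ball_sym.
  by apply: ball_triangle qv; exact: ball_sym.
apply: countable_bigcupT_measurable => // p; rewrite /F; case: ifP => // _.
by apply: measurableX; exact: measurable_ball.
Qed.

Lemma continuous_plane_measurable {R : realType} (f : R * R -> R) :
  continuous f ->
  measurable_fun [set: measurableTypeR R * measurableTypeR R] f.
Proof.
move=> /continuousP cf; apply: (measurability _ (RGenOpens.measurableE R)).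
move=> _ [_ [a [b ->] <-]]; rewrite setTI; apply: open_plane_measurable.
exact/cf/interval_open.
Qed.

Lemma compact_plane_measurable {R : realType} (K : set (R * R)) :
  compact K -> measurable (K : set (measurableTypeR R * measurableTypeR R)).
Proof.
move=> /compact_closed cK; rewrite -[K]setCK; apply: measurableC.
apply: open_plane_measurable; rewrite openC; apply: cK.
exact: norm_hausdorff.
Qed.

(** * Compact sets and partial derivatives in the plane *)

Section boxes.
Context {R : realType}.
Implicit Types (f u g : R * R -> R) (K : set (R * R)) (x : R * R).
Local Notation T2 := (measurableTypeR R * measurableTypeR R)%type.

Definition box (M : R) : set (R * R) := `[-M, M] `*` `[-M, M].

Lemma compact_sub_box K : compact K -> exists2 M, 0 < M & K `<=` box M.
Proof.
move=> /compact_bounded[M [_ KM]]; exists (`|M| + 1); first by rewrite ltr_pwDr.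
move=> x Kx; have := KM (`|M| + 1) _ x Kx.
rewrite ltr_pwDr ?ler_norm// => /(_ isT).
by rewrite /Num.norm/= ge_max => /andP[]; rewrite !ler_norml /box/= !in_itv/=.
Qed.

Lemma box_compact M : compact (box M).
Proof. by apply: compact_setX; exact: segment_compact. Qed.

Lemma leb2_box_lty M : (leb2 (box M) < +oo)%E.
Proof.
have -> : leb2 (box M) =
    (@lebesgue_measure R `[(- M)%R, M] * @lebesgue_measure R `[(- M)%R, M])%E.
  by apply: product_measure1E; exact: measurable_itv.
rewrite !lebesgue_measure_itv/=.
by case: ifP => _; rewrite ?mule0 ?ltry// -EFinM ltry.
Qed.

Lemma leb2_compact_lty K : compact K -> (leb2 K < +oo)%E.
Proof.
move=> cK; have [M _ KM] := compact_sub_box cK.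
apply: le_lt_trans (leb2_box_lty M); apply: le_measure; rewrite ?inE//.
- exact: compact_plane_measurable.
- by apply: compact_plane_measurable; exact: box_compact.
Qed.

Lemma continuous_compact_bounded f K : continuous f -> compact K ->
  [bounded f x | x in K].
Proof.
move=> cf cK; have /compact_bounded : compact (f @` K).
  by apply: continuous_compact => //; exact: continuous_subspaceT.
case=> M [Mr HM]; exists M; split=> // N MN x Kx.
by apply: HM => //; exists x.
Qed.

Lemma continuous_compact_integrable f K : continuous f -> compact K ->
  leb2.-integrable K (EFin \o f).
Proof.
move=> cf cK; apply: measurable_bounded_integrable.
- exact: compact_plane_measurable.
- exact: leb2_compact_lty.
- by apply: measurable_funS (continuous_plane_measurable cf).
- exact: continuous_compact_bounded.
Qed.

Lemma continuous_loc_integrable f : continuous f -> loc_integrable f.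
Proof.
move=> cf; split=> [|K cK]; first exact: continuous_plane_measurable.
exact: continuous_compact_integrable.
Qed.

(** Integrability on a compact set is what local integrability provides; this
    turns it into integrability on the plane. *)
Lemma compactly_supported_integrable (f : T2 -> \bar R) K :
  compact K -> leb2.-integrable K f -> (forall x, ~ K x -> f x = 0%E) ->
  leb2.-integrable setT f.
Proof.
move=> cK iK f0; have -> : f = f \_ K.
  by apply/funext => x; rewrite patchE; case: ifPn => // /negP; rewrite inE => /f0.
exact: (proj1 (integrable_mkcond f (compact_plane_measurable cK)) iK).
Qed.

End boxes.

Section partial_derivatives.
Context {R : realType}.
Implicit Types (f u g : R * R -> R) (K : set (R * R)) (x : R * R).

(** A directional derivative along a coordinate axis is a one-variable derivative
    of a slice: this is what gives access to one-variable calculus. *)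
Lemma is_derive_basis0 u x (d : R) :
  is_derive x (basis2 0) u d <-> is_derive x.1 1 (fun t => u (t, x.2)) d.
Proof.
have E : (fun h : R => h^-1 *: ((u \o shift x) (h *: basis2 0) - u x)) =
    (fun h : R => h^-1 *: (((fun t => u (t, x.2)) \o shift x.1) (h *: 1)
                           - u (x.1, x.2))).
  apply/funext => h; case: x => a b /=; congr (_ *: (u _ - _)).
  by congr pair; rewrite /= /GRing.scale /= ?mulr0 ?add0r.
by split=> -[df dE]; split; move: df dE; rewrite /derivable /derive E.
Qed.

Lemma is_derive_basis1 u x (d : R) :
  is_derive x (basis2 1) u d <-> is_derive x.2 1 (fun t => u (x.1, t)) d.
Proof.
have E : (fun h : R => h^-1 *: ((u \o shift x) (h *: basis2 1) - u x)) =
    (fun h : R => h^-1 *: (((fun t => u (x.1, t)) \o shift x.2) (h *: 1)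
                           - u (x.1, x.2))).
  apply/funext => h; case: x => a b /=; congr (_ *: (u _ - _)).
  by congr pair; rewrite /= /GRing.scale /= ?mulr0 ?add0r.
by split=> -[df dE]; split; move: df dE; rewrite /derivable /derive E.
Qed.

End partial_derivatives.

(** * Classical partial derivatives are weak ones *)

Section integration_by_parts.
Context {R : realType}.
Implicit Types (f u g F : R * R -> R) (K : set (R * R)).

(** The complement of a closed set is open, hence a function that vanishes there
    is locally constant at each of its points. *)
Lemma is_derive_vanish (V : normedModType R) (F f : V -> R) (v : V) (K : set V) :
  closed K -> (forall x : V, is_derive x v F (f x)) ->
  (forall x : V, ~ K x -> F x = 0) -> forall x : V, ~ K x -> f x = 0.
Proof.
move=> cK dF F0 x Kx; rewrite -(@derive_val _ _ _ _ _ _ _ (dF x)).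
rewrite -(derive_cst (0 : R) x v); apply: near_eq_derive.
have : nbhs x (~` K) by apply: open_nbhs_nbhs; split => //; exact: closed_openC.
by apply: filterS => y /F0.
Qed.

(** Outside a large segment both the function and its derivative vanish, so the
    fundamental theorem of calculus leaves two boundary terms equal to 0. *)
Lemma integral_derive_compact_support (G g : R -> R) (K : set R) : compact K ->
  continuous g -> (forall x : R, is_derive x 1 G (g x)) ->
  (forall x : R, ~ K x -> G x = 0) -> (\int[lebesgue_measure]_x (g x)%:E = 0)%E.
Proof.
move=> cK cg dG G0.
have [M M0 KM] : exists2 M, 0 < M & K `<=` `]- M, M[.
  have /compact_bounded[M [_ KM]] := cK; exists (`|M| + 2).
    by rewrite ltr_pwDr.
  move=> x Kx; have := KM (`|M| + 1) _ x Kx.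
  rewrite ltr_pwDr ?ler_norm// => /(_ isT) xM.
  by rewrite /= in_itv/= -ltr_norml (le_lt_trans xM)// ltrD2l ltr1n.
have g0 : forall x, ~ K x -> g x = 0.
  by apply: is_derive_vanish dG G0; exact: (compact_closed (@Rhausdorff R)).
have cG : continuous G.
  move=> x; apply/differentiable_continuous/derivable1_diffP.
  exact: (@ex_derive _ _ _ _ _ _ _ (dG x)).
have out y : y \notin `]- M, M[ -> ~ K y.
  by move=> yM /KM/= My; rewrite My in yM.
have -> : (\int[lebesgue_measure]_x (g x)%:E =
           \int[lebesgue_measure]_(x in `[(- M)%R, M]) (g x)%:E)%E.
  rewrite [RHS]integral_mkcond; apply: eq_integral => x _.
  rewrite patchE; case: ifPn => // xM; rewrite g0//; apply: out.
  by apply: contra xM => xM; rewrite inE/=; exact: subset_itv_oo_cc.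
rewrite (@continuous_FTC2 _ _ G)//.
- rewrite !G0 ?subee//; apply: out; rewrite in_itv/= ltxx ?andbF//.
- lra.
- exact: continuous_subspaceT.
- split=> [y _||]; first exact: (@ex_derive _ _ _ _ _ _ _ (dG y)).
  + by apply: cvg_at_right_filter; exact: cG.
  + by apply: cvg_at_left_filter; exact: cG.
- by move=> y _; rewrite derive1E (@derive_val _ _ _ _ _ _ _ (dG y)).
Qed.

Lemma continuous_slice0 f (y : R) : continuous f -> continuous (fun t => f (t, y)).
Proof.
move=> cf t; apply: (@continuous_comp _ _ _ (fun t => (t, y)) f); last exact: cf.
exact: (cvg_pair (G := nbhs t) (H := nbhs y) cvg_id (cvg_cst y)).
Qed.

Lemma continuous_slice1 f (y : R) : continuous f -> continuous (fun t => f (y, t)).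
Proof.
move=> cf t; apply: (@continuous_comp _ _ _ (fun t => (y, t)) f); last exact: cf.
exact: (cvg_pair (G := nbhs y) (H := nbhs t) (cvg_cst y) cvg_id).
Qed.

Lemma plane_closed K : compact K -> closed K.
Proof. by apply: compact_closed; exact: norm_hausdorff. Qed.

(** Fubini reduces to slices, integrating first along the direction of
    differentiation. *)
Lemma integral_partial_compact_support (j : 'I_2) (F f : R * R -> R) K :
  compact K -> continuous f -> (forall x, is_derive x (basis2 j) F (f x)) ->
  (forall x, ~ K x -> F x = 0) -> (\int[leb2]_x (f x)%:E = 0)%E.
Proof.
move=> cK cf dF F0.
have f0 := is_derive_vanish (plane_closed cK) dF F0.
have intf : leb2.-integrable setT (EFin \o f).
  apply: (compactly_supported_integrable cK).
    exact: continuous_compact_integrable.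
  by move=> x /f0 /= ->.
have [M M0 KM] := compact_sub_box cK.
have cI : compact (`[- M, M] : set R) by exact: segment_compact.
move: j dF => [[|[|//]] j2] dF.
- rewrite (_ : Ordinal j2 = 0) in dF; last exact: val_inj.
  rewrite -(integral21_prod_meas1 intf) /fubini_G.
  apply: integral0_eq => /= y _.
  apply: (@integral_derive_compact_support (fun t => F (t, y)) (fun t => f (t, y))
    _ cI (continuous_slice0 (y := y) cf)).
    by move=> x; have /is_derive_basis0 := dF (x, y).
  by move=> x xM; apply: F0 => /KM[].
- rewrite (_ : Ordinal j2 = 1) in dF; last exact: val_inj.
  rewrite -(integral12_prod_meas1 intf) /fubini_F.
  apply: integral0_eq => /= y _.
  apply: (@integral_derive_compact_support (fun t => F (y, t)) (fun t => f (y, t))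
    _ cI (continuous_slice1 (y := y) cf)).
    by move=> x; have /is_derive_basis1 := dF (y, x).
  by move=> x xM; apply: F0 => /KM[].
Qed.

Lemma test_fun_derive j phi : is_test_fun phi ->
  forall x : R * R, is_derive x (basis2 j) phi (partial j phi x).
Proof. by move=> [/(_ 1%N)[_ /(_ j)[dphi _]] _] x; split. Qed.

Lemma test_fun_partial_continuous j phi : is_test_fun phi ->
  continuous (partial j phi : R * R -> R).
Proof. by move=> [/(_ 1%N)[_ /(_ j)[_ [cphi _]]] _]. Qed.

(** The product of u with a test function is compactly supported, so the integral
    of its partial derivative is 0; Leibniz' rule splits it in two. *)
Lemma C1_weak_partial j u g : continuous u -> continuous g ->
  (forall x, is_derive x (basis2 j) u (g x)) -> is_weak_partial j u g.
Proof.
move=> cu cg du; split; [exact: continuous_loc_integrable..|move=> phi tphi].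
have [cphi _] := tphi.1 0%N; have dphi := test_fun_derive j tphi.
have cdphi := test_fun_partial_continuous (j := j) tphi.
pose K := closure [set x | phi x != 0].
have cK : compact K := tphi.2.
have phi0 x : ~ K x -> phi x = 0.
  move=> Kx; apply/eqP; apply: contrapT => /negP phix; apply: Kx.
  exact: subset_closure.
have dphi0 := is_derive_vanish (plane_closed cK) dphi phi0.
have cM (v w : R * R -> R) : continuous v -> continuous w ->
    continuous (fun x => v x * w x).
  by move=> cv cw x; apply: cvgM; [exact: cv|exact: cw].
have iM (v w : R * R -> R) : continuous v -> continuous w ->
    (forall x, ~ K x -> w x = 0) ->
    leb2.-integrable setT (fun x => (v x * w x)%:E).
  move=> cv cw w0; apply: (compactly_supported_integrable cK).
    exact: (continuous_compact_integrable (cM _ _ cv cw) cK).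
  by move=> x /w0 ->; rewrite mulr0.
have : (\int[leb2]_x (u x * partial j phi x + g x * phi x)%:E = 0)%E.
  apply: (integral_partial_compact_support cK (F := fun x => u x * phi x)).
  - move=> x; exact: (cvgD (cM _ _ cu cdphi x) (cM _ _ cg cphi x)).
  - move=> x; apply: is_derive_eq (is_deriveM (du x) (dphi x)) _.
    by rewrite /GRing.scale /= [phi x * _]mulrC.
  - by move=> x /phi0 ->; rewrite mulr0.
under eq_integral do rewrite EFinD.
have iu := iM _ _ cu cdphi dphi0; have ig := iM _ _ cg cphi phi0.
rewrite integralD//.
have /fineK <- := integrable_fin_num measurableT iu.
have /fineK <- := integrable_fin_num measurableT ig.
by move=> [] /eqP; rewrite addr_eq0 => /eqP ->; rewrite EFinN.
Qed.

End integration_by_parts.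

(** * Smooth bump functions *)

Section smooth_functions.
Context {R : realType}.
Implicit Types (f g : R -> R) (p : {poly R}) (c x : R).

(** The functions p(1/x) exp(-c/x), extended by 0 to x <= 0.  Letting p range
    over all polynomials makes the family stable under differentiation, which is
    how smoothness of exp(-1/x) is obtained by a plain induction. *)
Definition expinv p c x : R :=
  if 0 < x then p.[x^-1] * expR (- (c * x^-1)) else 0.

(** With t = 1/x >= 1, the polynomial is at most a multiple of t^n, whereas
    exp(ct) is at least (ct)^(n+1)/(n+1)!; hence a bound by a multiple of 1/t. *)
Lemma expinv_le_linear p c : 0 < c ->
  exists2 C, 0 <= C & forall x, 0 < x <= 1 -> `|expinv p c x| <= C * x.
Proof.
move=> c0; pose n := size p; pose S := \sum_(i < n) `|p`_i|.
have S0 : 0 <= S by apply: sumr_ge0.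
have f0 : 0 < (n.+1)`!%:R :> R by rewrite ltr0n fact_gt0.
exists (S * (n.+1)`!%:R / c ^+ n.+1) => [|x /andP[x0 x1]].
  by rewrite divr_ge0 ?mulr_ge0 ?ler0n// exprn_ge0// ltW.
rewrite /expinv x0 normrM (ger0_norm (expR_ge0 _)).
pose t := x^-1; have t1 : 1 <= t by rewrite invf_ge1.
have t0 : 0 < t by rewrite invr_gt0.
have pS : `|p.[t]| <= S * t ^+ n.
  rewrite horner_coef mulr_suml (le_trans (ler_norm_sum _ _ _))//.
  apply: ler_sum => i _; rewrite normrM ler_wpM2l// normrX (gtr0_norm t0).
  by rewrite ler_weXn2l// ltnW.
have ct0 : 0 < c * t by rewrite mulr_gt0.
have eS : expR (- (c * t)) <= (n.+1)`!%:R / (c * t) ^+ n.+1.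
  rewrite expRN -[leRHS]invrK lef_pV2 ?posrE ?expR_gt0 ?invr_gt0 ?divr_gt0//;
    last by rewrite exprn_gt0.
  rewrite invf_div; apply: le_trans (expR_ge1Dxn n (ltW ct0)).
  by rewrite lerDr.
rewrite -/t; apply: le_trans (ler_pM (normr_ge0 _) (expR_ge0 _) pS eS) _.
rewrite exprMn [t ^+ n.+1]exprS -[x]invrK -/t.
rewrite le_eqVlt; apply/orP; left; apply/eqP; field.
by rewrite !gt_eqF// exprn_gt0.
Qed.

Lemma near_is_derive f g x d : (\forall y \near x, f y = g y) ->
  is_derive x 1 f d -> is_derive x 1 g d.
Proof.
move=> fg [df <-]; split; first exact: near_eq_derivable df.
by apply/esym/near_eq_derive.
Qed.

(** The only delicate point is 0, where the difference quotient is the function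
    of the same family for the polynomial X p, hence is O(x). *)
Lemma is_derive_expinv p c x : 0 < c ->
  is_derive x 1 (expinv p c) (expinv ('X^2 * (c *: p - p^`())) c x).
Proof.
move=> c0; have [x0|x0|->] := ltgtP x 0.
- suff : is_derive x 1 (cst 0 : R -> R) (expinv ('X^2 * (c *: p - p^`())) c x).
    apply: near_is_derive; apply: filterS (lt_nbhsl x0) => y y0.
    by rewrite /expinv ltNge ltW.
  by rewrite /expinv ltNge ltW//=; exact: is_derive_cst.
- pose F := (horner p \o GRing.inv) * (expR \o (fun y => - (c * y^-1))).
  have dV : is_derive x 1 GRing.inv (- x ^- 2 : R).
    have := @is_deriveV R id x 1 1 (lt0r_neq0 x0) (is_derive_id _ _).
    by rewrite /GRing.scale/= mulr1.
  have dp := @is_derive1_comp R (horner p) GRing.inv x _ _ (is_derive_poly p x^-1) dV.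
  have dc : is_derive x 1 (fun y => - (c * y^-1)) (c * x ^- 2).
    have := is_deriveN (is_deriveZ c dV).
    by rewrite /GRing.scale/= mulrN opprK.
  have de := @is_derive1_comp R expR _ x _ _ (is_derive_expR _) dc.
  have dF := is_deriveM dp de.
  suff : is_derive x 1 F (expinv ('X^2 * (c *: p - p^`())) c x).
    by apply: near_is_derive; apply: filterS (lt_nbhsr x0) => y y0; rewrite /expinv y0.
  apply: is_derive_eq dF _; rewrite /expinv x0 !hornerE/= /GRing.scale/=.
  rewrite -exprVn; ring.
- have dq : (fun h : R => h^-1 *: ((expinv p c \o shift 0) (h *: 1) - expinv p c 0))
      h @[h --> 0^'] --> (0 : R).
    have [C C0 HC] := expinv_le_linear ('X * p) c0.
    apply: (@cvg_to_0_linear _ _ C 1) => // h /andP[h0 h1] /=.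
    rewrite /GRing.scale/= addr0 mulr1 {2}/expinv ltxx subr0.
    have [hp|hn] := ltP 0 h; last first.
      by rewrite /expinv ltNge hn/= mulr0 normr0 mulr_ge0.
    have -> : h^-1 * expinv p c h = expinv ('X * p) c h.
      by rewrite /expinv hp hornerM hornerX mulrA.
    by rewrite (gtr0_norm hp) in h1 *; apply: HC; rewrite hp ltW.
  rewrite {2}/expinv ltxx; split; first by apply/cvg_ex; exists 0.
  exact: cvg_lim dq.
Qed.

(** The derivative is given relationally, which avoids any computation with the
    derivation operator when closing the class under products and dilations. *)
Fixpoint smooth1 (k : nat) f : Prop :=
  continuous f /\
  (if k is k'.+1 then
     exists2 g, (forall x : R, is_derive x 1 f (g x)) & smooth1 k' g
   else True).

Lemma smooth1W k f : smooth1 k.+1 f -> smooth1 k f.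
Proof.
elim: k f => [|k IH] f [cf [g dg sg]]; split => //.
by exists g => //; exact: IH.
Qed.

Lemma is_derive_continuous f g : (forall x : R, is_derive x 1 f (g x)) ->
  continuous f.
Proof.
move=> df x; apply/differentiable_continuous/derivable1_diffP.
exact: (@ex_derive _ _ _ _ _ _ _ (df x)).
Qed.

Lemma smooth1_expinv k p c : 0 < c -> smooth1 k (expinv p c).
Proof.
move=> c0; have dE q x := is_derive_expinv q x c0.
elim: k p => [|k IH] p; (split; first exact: is_derive_continuous (dE p)) => //.
by exists (expinv ('X^2 * (c *: p - p^`())) c).
Qed.

Lemma smooth1D k f g : smooth1 k f -> smooth1 k g ->
  smooth1 k (fun x => f x + g x).
Proof.
elim: k f g => [|k IH] f g [cf Hf] [cg Hg].
  by split=> // x; apply: cvgD; [exact: cf|exact: cg].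
split; first by move=> x; apply: cvgD; [exact: cf|exact: cg].
have [[f' df sf'] [g' dg sg']] := (Hf, Hg).
exists (fun x => f' x + g' x); last exact: IH.
by move=> x; exact: is_deriveD.
Qed.

Lemma smooth1M k f g : smooth1 k f -> smooth1 k g ->
  smooth1 k (fun x => f x * g x).
Proof.
elim: k f g => [|k IH] f g Hf Hg.
  by split=> // x; apply: cvgM; [exact: (Hf.1)|exact: (Hg.1)].
have [cf [f' df sf']] := Hf; have [cg [g' dg sg']] := Hg.
split; first by move=> x; apply: cvgM; [exact: cf|exact: cg].
exists (fun x => f x * g' x + g x * f' x); last first.
  by apply: smooth1D; apply: IH => //; exact: smooth1W.
by move=> x; exact: is_deriveM.
Qed.

Lemma smooth1_cst k (a : R) : smooth1 k (cst a).
Proof.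
elim: k a => [|k IH] a; (split; first by move=> x; exact: cvg_cst) => //.
by exists (cst 0); [move=> x; exact: is_derive_cst|exact: IH].
Qed.

Lemma smooth1_affine k f (s t : R) :
  smooth1 k f -> smooth1 k (fun x => f (s * x + t)).
Proof.
have da x : is_derive x 1 (fun x => s * x + t) s.
  by apply: is_derive_eq; rewrite /GRing.scale/= mulr1 addr0.
have ca := is_derive_continuous da.
have cc g : continuous g -> continuous (fun x => g (s * x + t)).
  move=> cg x; apply: (@continuous_comp _ _ _ (fun x => s * x + t) g).
    exact: ca.
  exact: cg.
elim: k f => [|k IH] f [cf Hf]; (split; first exact: cc) => //.
have [g df sg] := Hf; exists (fun x => g (s * x + t) * s).
  by move=> x; apply: (@is_derive1_comp _ f (fun x => s * x + t)).
apply: smooth1M; [exact: IH|exact: smooth1_cst].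
Qed.

Definition tensor f g : R * R -> R := fun z => f z.1 * g z.2.

Lemma tensor_continuous f g :
  continuous f -> continuous g -> continuous (tensor f g).
Proof.
move=> cf cg z; apply: cvgM.
  by apply: (@continuous_comp _ _ _ fst f); [exact: cvg_fst|exact: cf].
by apply: (@continuous_comp _ _ _ snd g); [exact: cvg_snd|exact: cg].
Qed.

Lemma tensor_Ck k f g : smooth1 k f -> smooth1 k g -> is_Ck k (tensor f g).
Proof.
elim: k f g => [|k IH] f g Hf Hg.
  by split=> //; apply: tensor_continuous; [exact: Hf.1|exact: Hg.1].
have [cf [f' df sf']] := Hf; have [cg [g' dg sg']] := Hg.
split; first exact: tensor_continuous.
have d0 (x : R * R) : is_derive x (basis2 0) (tensor f g) (tensor f' g x).
  apply/is_derive_basis0; rewrite /tensor /=.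
  apply: is_derive_eq (is_deriveM (df x.1) (is_derive_cst (g x.2) x.1 1)) _.
  by rewrite /GRing.scale/= mulr0 add0r mulrC.
have d1 (x : R * R) : is_derive x (basis2 1) (tensor f g) (tensor f g' x).
  apply/is_derive_basis1; rewrite /tensor /=.
  apply: is_derive_eq (is_deriveM (is_derive_cst (f x.1) x.2 1) (dg x.2)) _.
  by rewrite /GRing.scale/= mulr0 addr0.
have step j (h : R * R -> R) : is_Ck k h ->
    (forall x : R * R, is_derive x (basis2 j) (tensor f g) (h x)) ->
    (forall z, derivable (tensor f g) z (basis2 j)) /\
    is_Ck k (partial j (tensor f g)).
  move=> Ckh dh; split; first by move=> x; have [] := dh x.
  suff -> : partial j (tensor f g) = h by [].
  by apply/funext => x; have [_] := dh x.
case=> -[|[|//]] j2.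
- rewrite (_ : Ordinal j2 = 0); last exact: val_inj.
  by apply: step d0; apply: IH => //; exact: smooth1W.
- rewrite (_ : Ordinal j2 = 1); last exact: val_inj.
  by apply: step d1; apply: IH => //; exact: smooth1W.
Qed.

(** Since expinv 1 c is exp(-c/x) for x > 0, taking c = 1/(n+1) makes the bumps
    converge pointwise to the indicator of ]a, b[ while staying in [0, 1]. *)
Definition bump (a b : R) (n : nat) (x : R) : R :=
  expinv 1 n.+1%:R^-1 (x - a) * expinv 1 n.+1%:R^-1 (b - x).

Lemma smooth1_bump k a b n : smooth1 k (bump a b n).
Proof.
have n0 : 0 < n.+1%:R^-1 :> R by rewrite invr_gt0.
rewrite (_ : bump a b n = fun x => expinv 1 n.+1%:R^-1 (1 * x + - a) *
                                   expinv 1 n.+1%:R^-1 ((-1) * x + b)).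
  by apply: smooth1M; apply: smooth1_affine; exact: smooth1_expinv.
by apply/funext => x; rewrite mul1r mulN1r [- x + b]addrC.
Qed.

Lemma expinv1_itv c x : 0 < c -> 0 <= expinv 1 c x <= 1.
Proof.
move=> c0; rewrite /expinv; case: ifPn => [x0|]; last by rewrite lexx ler01.
rewrite hornerC mul1r expR_ge0/= -[leRHS]expR0 ler_expR oppr_le0.
by rewrite mulr_ge0 ?invr_ge0 ?ltW.
Qed.

Lemma bump_itv a b n x : 0 <= bump a b n x <= 1.
Proof.
have n0 : 0 < n.+1%:R^-1 :> R by rewrite invr_gt0.
have /andP[u0 u1] := expinv1_itv (x - a) n0.
have /andP[v0 v1] := expinv1_itv (b - x) n0.
by rewrite /bump mulr_ge0//= mulr_ile1.
Qed.

Lemma bump_out a b n x : x \notin `]a, b[ -> bump a b n x = 0.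
Proof.
rewrite in_itv/= negb_and -!leNgt => /orP[xa|bx]; rewrite /bump /expinv.
  by rewrite [0 < x - a]subr_gt0 ltNge xa mul0r.
by rewrite [0 < b - x]subr_gt0 [X in _ * X]ifF ?mulr0// ltNge bx.
Qed.

Lemma expinv1_cvg x : 0 < x ->
  expinv 1 n.+1%:R^-1 x @[n --> \oo] --> (1 : R).
Proof.
move=> x0; rewrite /expinv x0; under eq_fun do rewrite hornerC mul1r.
have h : - (n.+1%:R^-1 * x^-1) @[n --> \oo] --> (- (0 * x^-1) : R).
  by apply: cvgN; apply: cvgM; [exact: cvg_harmonic|exact: cvg_cst].
rewrite mul0r oppr0 in h.
suff : expR (- (n.+1%:R^-1 * x^-1)) @[n --> \oo] --> (expR 0 : R) by rewrite expR0.
by apply: continuous_cvg h; exact: continuous_expR.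
Qed.

Lemma bump_cvg a b x :
  bump a b n x @[n --> \oo] --> (\1_(`]a, b[) x : R).
Proof.
rewrite indicE mem_setE; case: (boolP (x \in `]a, b[)) => [|/bump_out xab].
  rewrite in_itv/= => /andP[ax xb]; rewrite -[X in _ --> X](mulr1 1).
  by apply: cvgM; apply: expinv1_cvg; rewrite subr_gt0.
by under eq_fun do rewrite xab; exact: cvg_cst.
Qed.

Lemma tensor_bump_test a b c d n :
  is_test_fun (tensor (bump a b n) (bump c d n)).
Proof.
split=> [k|]; first by apply: tensor_Ck; exact: smooth1_bump.
have cK : compact (`[a, b] `*` `[c, d] : set (R * R)).
  by apply: compact_setX; exact: segment_compact.
apply: (subclosed_compact _ cK); first exact: closed_closure.
rewrite [X in _ `<=` X](closure_id _).1; last exact: plane_closed.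
apply: closure_subset => -[x y]/=; rewrite /tensor /= mulf_eq0 negb_or.
move=> /andP[bx dy]; split => /=; apply: subset_itv_oo_cc.
  by apply: contraNT bx => /bump_out ->.
by apply: contraNT dy => /bump_out ->.
Qed.

End smooth_functions.

(** * Open rectangles determine integrals *)

Section open_rectangles.
Context {R : realType}.
Local Notation T2 := (measurableTypeR R * measurableTypeR R)%type.

Definition open_rect (a b c d : R) : set (R * R) := `]a, b[ `*` `]c, d[.

Definition open_rects : set (set (R * R)) :=
  [set S | exists a b c d, S = open_rect a b c d].

Lemma open_rects_setI : setI_closed open_rects.
Proof.
move=> _ _ [a [b [c [d ->]]]] [a' [b' [c' [d' ->]]]].
exists (Num.max a a'), (Num.min b b'), (Num.max c c'), (Num.min d d').
apply/seteqP; split => -[x y]; rewrite /open_rect/= !in_itv/= !gt_max !lt_min.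
  by move=> [[/andP[-> ->] /andP[-> ->]] [/andP[-> ->] /andP[-> ->]]].
by move=> [/andP[/andP[-> ->] /andP[-> ->]] /andP[/andP[-> ->] /andP[-> ->]]].
Qed.

Lemma open_rect_measurable a b c d :
  measurable (open_rect a b c d : set T2).
Proof. by apply: measurableX; exact: measurable_itv. Qed.

Lemma real_natB (x : R) : exists n : nat, - n%:R < x < n%:R.
Proof.
exists (Num.truncn `|x|).+1; rewrite -ltr_norml.
by rewrite real_truncnS_gt ?num_real.
Qed.

(** Bounded rectangles suffice: the preimage of an interval by a coordinate is a
    strip, which is a countable union of bounded rectangles. *)
Lemma measurable_open_rects :
  @measurable _ T2 = <<s open_rects >>.
Proof.
have mfst : measurable_fun (setT : set (g_sigma_algebraType open_rects))
    (fst : g_sigma_algebraType open_rects -> measurableTypeR R).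
  apply: (measurability _ (RGenOpens.measurableE R)) => _ [_ [a [b ->] <-]].
  rewrite setTI (_ : _ @^-1` _ = \bigcup_n open_rect a b (- n%:R) n%:R).
    apply: bigcupT_measurable => n; apply: sub_sigma_algebra.
    by exists a, b, (- n%:R), n%:R.
  apply/seteqP; split => [[x y] /= xab|[x y] [n _ []]//].
  by have [n yn] := real_natB y; exists n => //; split => //=; rewrite in_itv.
have msnd : measurable_fun (setT : set (g_sigma_algebraType open_rects))
    (snd : g_sigma_algebraType open_rects -> measurableTypeR R).
  apply: (measurability _ (RGenOpens.measurableE R)) => _ [_ [a [b ->] <-]].
  rewrite setTI (_ : _ @^-1` _ = \bigcup_n open_rect (- n%:R) n%:R a b).
    apply: bigcupT_measurable => n; apply: sub_sigma_algebra.
    by exists (- n%:R), n%:R, a, b.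
  apply/seteqP; split => [[x y] /= yab|[x y] [n _ []]//].
  by have [n xn] := real_natB x; exists n => //; split => //=; rewrite in_itv.
apply/seteqP; split.
  rewrite measurable_prod_measurableType.
  apply: smallest_sub; first exact: smallest_sigma_algebra.
  move=> _ [A mA] [B mB] <-.
  have -> : A `*` B = (fst @^-1` A) `&` (snd @^-1` B) by [].
  apply: (@measurableI _ (g_sigma_algebraType open_rects)).
    by rewrite -[X in measurable X]setTI; exact: mfst.
  by rewrite -[X in measurable X]setTI; exact: msnd.
apply: smallest_sub; first exact: sigma_algebra_measurable.
by move=> _ [a [b [c [d ->]]]]; exact: open_rect_measurable.
Qed.

(** The sets S such that g has integral 0 on the intersection of S with Q form a
    Dynkin system, and open rectangles are stable under intersection. *)
Lemma ae_eq0_open_rects (g : T2 -> R) a b c d :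
  let Q := open_rect a b c d in
  leb2.-integrable Q (EFin \o g) ->
  (forall S, open_rects S -> S `<=` Q -> (\int[leb2]_(x in S) (g x)%:E = 0)%E) ->
  ae_eq leb2 Q (EFin \o g) (cst 0%E).
Proof.
move=> Q ig g0.
have mQ : measurable (Q : set T2) by exact: open_rect_measurable.
have rQ : open_rects Q by exists a, b, c, d.
have igS (S : set T2) : measurable S -> leb2.-integrable (S `&` Q) (EFin \o g).
  move=> mS; apply: integrableS ig => //; exact: measurableI.
have mS0 (S : set T2) : measurable S -> (\int[leb2]_(x in S `&` Q) (g x)%:E = 0)%E.
  move=> mS; have := mS; rewrite measurable_open_rects; move: S {mS}.
  apply: (@dynkin_induction _ T2 _
    [set S | (\int[leb2]_(x in S `&` Q) (g x)%:E = 0)%E]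
    measurable_open_rects open_rects_setI) => /=.
  - by rewrite setTI; exact: g0.
  - move=> S rS; apply: g0; [exact: open_rects_setI|by move=> x []].
  - move=> S mS S0; have := g0 _ rQ (@subset_refl _ Q).
    have -> : Q = (S `&` Q) `|` (~` S `&` Q) by rewrite -setIUl setUv setTI.
    rewrite integral_setU//=.
    + by rewrite -setIUl setUv setTI S0 add0e.
    + exact: measurableI.
    + by apply: measurableI => //; exact: measurableC.
    + by rewrite -setIUl setUv setTI; exact: (measurable_int _ ig).
    + by apply/disj_setPS => x [[Sx _] [nSx _]].
  - move=> F mF tF F0; rewrite setI_bigcupl integral_bigcup//=.
    + by apply: eseries0 => n _ _; exact: F0.
    + by apply: trivIset_setIr.
    + by move=> k; exact: measurableI.
    + by rewrite -setI_bigcupl; apply: igS; exact: bigcupT_measurable.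
apply: (integral_ae_eq mQ ig); first exact: measurable_cst.
move=> E EQ mE; rewrite integral0 -(setIidl EQ); exact: mS0.
Qed.

End open_rectangles.

(** * Uniqueness of weak derivatives *)

Section weak_uniqueness.
Context {R : realType}.
Local Notation T2 := (measurableTypeR R * measurableTypeR R)%type.
Implicit Types (g : R * R -> R).

(** Dominated convergence along tensor products of bumps, which tend to the
    indicator of the open rectangle and are bounded by that of the closed one. *)
Lemma integral_open_rect_eq0 g a b c d : loc_integrable g ->
  (forall phi, is_test_fun phi -> (\int[leb2]_x (g x * phi x)%:E = 0)%E) ->
  (\int[leb2]_(x in open_rect a b c d) (g x)%:E = 0)%E.
Proof.
move=> [mg ig] g0; pose Q := open_rect a b c d.
have mQ : measurable (Q : set T2) by exact: open_rect_measurable.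
pose K : set (R * R) := `[a, b] `*` `[c, d].
have cK : compact K by apply: compact_setX; exact: segment_compact.
have mK := compact_plane_measurable cK.
pose t n := tensor (bump a b n) (bump c d n).
have tt n : is_test_fun (t n) by exact: tensor_bump_test.
have t1 n z : 0 <= t n z <= 1.
  have /andP[? ?] := bump_itv a b n z.1; have /andP[? ?] := bump_itv c d n z.2.
  by rewrite mulr_ge0//= mulr_ile1.
have QK : Q `<=` K.
  by move=> z [za zc]; split; apply: subset_itv_oo_cc.
have t0 n z : ~ Q z -> t n z = 0.
  move=> Qz; rewrite /t /tensor.
  have [z1|z1] := boolP (z.1 \in `]a, b[); last by rewrite (bump_out _ z1) mul0r.
  have [z2|z2] := boolP (z.2 \in `]c, d[); last by rewrite (bump_out _ z2) mulr0.
  by exfalso; apply: Qz.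
pose f_ n (z : T2) := (g z * t n z)%:E.
have mf_ n : measurable_fun [set: T2] (f_ n).
  apply/measurable_EFinP/measurable_funM => //.
  by apply: continuous_plane_measurable; have [] := (tt n).1 0%N.
have mf : measurable_fun [set: T2] ((EFin \o g) \_ Q).
  apply/(measurable_restrictT _ mQ); apply: measurable_funTS.
  exact/measurable_EFinP.
have cf (z : T2) : f_ ^~ z @ \oo --> ((EFin \o g) \_ Q) z.
  rewrite patchE; case: ifPn => [|/negP]; rewrite inE.
    move=> [za zc]; apply: cvg_EFin; first exact: nearW.
    rewrite -[X in _ --> X]mulr1.
    apply: (cvgM (cvg_cst (g z))); rewrite -[X in _ --> X]mulr1.
    have := @bump_cvg R a b z.1; rewrite indicE mem_set// => h1.
    have := @bump_cvg R c d z.2; rewrite indicE mem_set// => h2.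
    exact: (cvgM h1 h2).
  move=> Qz; rewrite /f_; under eq_fun do rewrite t0// mulr0.
  exact: cvg_cst.
have igK := integrable_abse (ig _ cK).
have := proj1 (integrable_mkcond _ mK) igK.
set h := (_ \_ _) => ih.
have dom (z : T2) n : (`|f_ n z| <= h z)%E.
  rewrite /h patchE; case: ifPn => [_|/negP]; rewrite ?inE.
    have /andP[tn0 tn1] := t1 n z.
    by rewrite /f_ /= lee_fin normrM (ger0_norm tn0) ler_piMr.
  by move=> Kz; rewrite /f_ t0 ?mulr0 ?abse0// => /QK.
have [_ _ lim] := dominated_convergence measurableT mf_ mf
  (aeW _ (fun z _ => cf z)) ih (aeW _ (fun z n _ => dom z n)).
rewrite integral_mkcond.
apply: (cvg_unique _ lim); first exact: ereal_hausdorff.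
rewrite (_ : (fun _ => _) = cst 0%E); first exact: cvg_cst.
by apply/funext => n; exact: g0.
Qed.

(** The fundamental lemma of the calculus of variations. *)
Lemma du_bois_reymond g : loc_integrable g ->
  (forall phi, is_test_fun phi -> (\int[leb2]_x (g x * phi x)%:E = 0)%E) ->
  {ae leb2, forall x : T2, g x = 0}.
Proof.
move=> lg g0; have [mg ig] := lg.
pose Q n : set (R * R) := open_rect (- n%:R) n%:R (- n%:R) n%:R.
have Qae n : ae_eq leb2 (Q n) (EFin \o g) (cst 0%E).
  apply: ae_eq0_open_rects.
    apply: (@integrableS _ T2 R leb2 (box n%:R)).
    - by apply: compact_plane_measurable; exact: box_compact.
    - exact: open_rect_measurable.
    - by move=> z [za zc]; split; apply: subset_itv_oo_cc.
    - by apply: ig; exact: box_compact.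
  by move=> _ [a [b [c [d ->]]]] _; exact: integral_open_rect_eq0.
have := @ae_foralln _ _ _ leb2 (fun n x => Q n x -> (EFin \o g) x = cst 0%E x) Qae.
apply: filterS => -[x y] H.
have [n xn] := real_natB x; have [m ym] := real_natB y.
suff Qxy : Q (maxn n m) (x, y) by have [] := H _ Qxy.
split; rewrite /= in_itv/=.
  move: xn => /andP[x1 x2]; apply/andP; split.
    by apply: le_lt_trans x1; rewrite lerN2 ler_nat leq_maxl.
  by apply: lt_le_trans x2 _; rewrite ler_nat leq_maxl.
move: ym => /andP[x1 x2]; apply/andP; split.
  by apply: le_lt_trans x1; rewrite lerN2 ler_nat leq_maxr.
by apply: lt_le_trans x2 _; rewrite ler_nat leq_maxr.
Qed.

Lemma loc_integrable_test g phi : loc_integrable g -> is_test_fun phi ->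
  leb2.-integrable setT (fun x => (g x * phi x)%:E).
Proof.
move=> [mg ig] [Ck cK]; have [cphi _] := Ck 0%N.
have := continuous_compact_bounded cphi cK.
case=> M [_ HM]; pose C := `|M| + 1.
apply: (compactly_supported_integrable cK); last first.
  move=> x Kx; suff -> : phi x = 0 by rewrite mulr0.
  apply/eqP; apply: contrapT => /negP phix; apply: Kx; exact: subset_closure.
have mK := compact_plane_measurable cK.
apply: (le_integrable mK _ _ (integrableZr mK C (ig _ cK))).
  apply/measurable_EFinP/measurable_funTS/measurable_funM => //.
  exact: continuous_plane_measurable.
move=> x Kx; rewrite -[leRHS]/(`|(g x * C)%:E|)%E !abse_EFin lee_fin !normrM.
rewrite ler_wpM2l//.
rewrite (le_trans (HM C _ x Kx))//; first by rewrite ltr_pwDr// ler_norm.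
exact: ler_norm.
Qed.

Lemma weak_partial_unique j u g1 g2 :
  is_weak_partial j u g1 -> is_weak_partial j u g2 ->
  {ae leb2, forall x : T2, g1 x = g2 x}.
Proof.
move=> [_ l1 w1] [_ l2 w2].
have lB : loc_integrable (fun x => g1 x - g2 x).
  have [[m1 i1] [m2 i2]] := (l1, l2).
  split=> [|K cK]; first exact: measurable_funB.
  have := integrableB (compact_plane_measurable cK) (i1 _ cK) (i2 _ cK).
  by apply: eq_integrable => //; exact: compact_plane_measurable.
have : {ae leb2, forall x : T2, g1 x - g2 x = 0}.
  apply: du_bois_reymond lB _ => phi tphi.
  under eq_integral do rewrite mulrBl EFinB.
  rewrite integralB//; [|exact: loc_integrable_test..].
  have := w1 _ tphi; rewrite (w2 _ tphi) => /oppe_inj ->.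
  rewrite subee//; apply: integrable_fin_num => //.
  exact: loc_integrable_test.
by apply: filterS => x /eqP; rewrite subr_eq0 => /eqP.
Qed.

Lemma weak_partialP j (u g : R * R -> R) : is_weak_partial j u g ->
  is_weak_partial j u (weak_partial j u).
Proof. by move=> ug; apply: (@xgetI _ (cst 0) [set g | is_weak_partial j u g] g). Qed.

Lemma weak_partial_ae j u g : is_weak_partial j u g ->
  {ae leb2, forall x : T2, weak_partial j u x = g x}.
Proof. by move=> ug; exact: weak_partial_unique (weak_partialP ug) ug. Qed.

Lemma weak_partial_measurable j u g : is_weak_partial j u g ->
  measurable_fun [set: T2] (weak_partial j u).
Proof. by move=> /weak_partialP[_ []]. Qed.

End weak_uniqueness.

(** * Pointwise calculus on stretched skyrmions *)

Section skyrmion_calculus.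
Context {R : realType}.
Implicit Types (a b : R) (z : R * R) (j : 'I_2) (i : 'I_3).

Lemma vec3E (a b c : R) (i : 'I_3) : vec3 a b c 0 i = [:: a; b; c]`_i.
Proof. by rewrite mxE. Qed.

Lemma rowB (v w : 'rV[R]_3) i : (v - w) 0 i = v 0 i - w 0 i.
Proof. by rewrite !mxE. Qed.

Lemma sum3 (F : 'I_3 -> R) : \sum_(i < 3) F i = F 0 + F 1 + F 2.
Proof.
rewrite !big_ord_recl big_ord0 addr0 addrA.
by congr (F _ + F _ + F _); exact: val_inj.
Qed.

Lemma sum2 (F : 'I_2 -> R) : \sum_(j < 2) F j = F 0 + F 1.
Proof.
rewrite !big_ord_recl big_ord0 addr0.
by congr (F _ + F _); exact: val_inj.
Qed.

Lemma ord2E j : j = 0 \/ j = 1.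
Proof. by case: j => -[|[|//]] j2; [left|right]; exact: val_inj. Qed.

Lemma ord3E i : [\/ i = 0, i = 1 | i = 2].
Proof.
by case: i => -[|[|[|//]]] i3; [apply: Or31|apply: Or32|apply: Or33];
  exact: val_inj.
Qed.

(** The conformal factor of the inverse stereographic projection, up to a
    constant: every component of h and of its derivatives is polynomial in the
    coordinates and qh. *)
Definition qh z : R := (1 + (z.1 ^+ 2 + z.2 ^+ 2))^-1.

(** The classical partial derivatives of the components of h. *)
Definition dh j i z : R :=
  if j == 0 then
    [:: 4 * z.1 * z.2 * qh z ^+ 2; 2 * qh z - 4 * z.1 ^+ 2 * qh z ^+ 2;
        4 * z.1 * qh z ^+ 2]`_i
  else
    [:: 4 * z.2 ^+ 2 * qh z ^+ 2 - 2 * qh z; - (4 * z.1 * z.2 * qh z ^+ 2);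
        4 * z.2 * qh z ^+ 2]`_i.

Definition scale a b z : R * R := (a * z.1, b * z.2).

(** The stretched skyrmions n_(a,b). *)
Definition sk a b z : 'rV[R]_3 := hmap (scale a b z).

Lemma den_gt0 z : 0 < 1 + (z.1 ^+ 2 + z.2 ^+ 2).
Proof. by rewrite ltr_pwDl// addr_ge0 ?sqr_ge0. Qed.

Lemma qh_gt0 z : 0 < qh z.
Proof. by rewrite invr_gt0 den_gt0. Qed.

Lemma hmapE z i :
  hmap z 0 i = [:: (-2 * z.2) * qh z; (2 * z.1) * qh z; 1 - 2 * qh z]`_i.
Proof.
rewrite /hmap vec3E -/(qh z).
case: (ord3E i) => -> //=; rewrite /qh.
by field; rewrite gt_eqF ?den_gt0.
Qed.

Lemma cvg_sqr (T : Type) (F : set_system T) (FF : Filter F) (f : T -> R) (l : R) :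
  f t @[t --> F] --> l -> f t ^+ 2 @[t --> F] --> l ^+ 2.
Proof. by move=> fl; rewrite expr2; exact: cvgM. Qed.

Lemma continuous_qh : continuous (qh : R * R -> R).
Proof.
move=> z; apply: cvgV; first by rewrite gt_eqF ?den_gt0.
apply: cvgD; first exact: cvg_cst.
by apply: cvgD; apply: cvg_sqr; [exact: cvg_fst|exact: cvg_snd].
Qed.

Lemma continuous_qh2 : continuous (fun z => qh z ^+ 2).
Proof. by move=> z; apply: cvg_sqr; exact: continuous_qh. Qed.

Lemma continuous_mulf (f g : R * R -> R) :
  continuous f -> continuous g -> continuous (fun z => f z * g z).
Proof. by move=> cf cg z; apply: cvgM; [exact: cf|exact: cg]. Qed.

Lemma continuous_subf (f g : R * R -> R) :
  continuous f -> continuous g -> continuous (fun z => f z - g z).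
Proof. by move=> cf cg z; apply: cvgB; [exact: cf|exact: cg]. Qed.

Lemma continuous_cstM (c : R) (f : R * R -> R) :
  continuous f -> continuous (fun z => c * f z).
Proof. by apply: continuous_mulf => z; exact: cvg_cst. Qed.
Arguments continuous_cstM c {f}.

Lemma continuous_hmap i : continuous (component hmap i : R * R -> R).
Proof.
rewrite (_ : component hmap i =
  fun z => [:: (-2 * z.2) * qh z; (2 * z.1) * qh z; 1 - 2 * qh z]`_i); last first.
  by apply/funext => w; rewrite /component hmapE.
have cX : continuous (fun z : R * R => z.1) by move=> z; exact: cvg_fst.
have cY : continuous (fun z : R * R => z.2) by move=> z; exact: cvg_snd.
case: (ord3E i) => -> /=.
- exact: (continuous_mulf (continuous_cstM (-2) cY) continuous_qh).
- exact: (continuous_mulf (continuous_cstM 2 cX) continuous_qh).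
- apply: continuous_subf (continuous_cstM 2 continuous_qh).
  by move=> z; exact: cvg_cst.
Qed.

Lemma continuous_dh j i : continuous (dh j i).
Proof.
have cX : continuous (fun z : R * R => z.1) by move=> z; exact: cvg_fst.
have cY : continuous (fun z : R * R => z.2) by move=> z; exact: cvg_snd.
have cX2 : continuous (fun z : R * R => z.1 ^+ 2).
  by move=> z; apply: cvg_sqr; exact: cX.
have cY2 : continuous (fun z : R * R => z.2 ^+ 2).
  by move=> z; apply: cvg_sqr; exact: cY.
have cq := continuous_cstM 2 continuous_qh.
have cXY := continuous_mulf (continuous_mulf (continuous_cstM 4 cX) cY)
  continuous_qh2.
case: (ord2E j) => ->; case: (ord3E i) => ->; rewrite /dh /=.
- exact: cXY.
- exact: (continuous_subf cq (continuous_mulf (continuous_cstM 4 cX2) continuous_qh2)).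
- exact: (continuous_mulf (continuous_cstM 4 cX) continuous_qh2).
- exact: (continuous_subf (continuous_mulf (continuous_cstM 4 cY2) continuous_qh2) cq).
- by move=> z; apply: cvgN; exact: cXY.
- exact: (continuous_mulf (continuous_cstM 4 cY) continuous_qh2).
Qed.

Lemma is_derive_qh0 z : is_derive z (basis2 0) qh (- (2 * z.1 * qh z ^+ 2)).
Proof.
apply/is_derive_basis0; case: z => x y /=.
have dg : is_derive x 1 (fun t : R => 1 + (t ^+ 2 + y ^+ 2)) (2 * x).
  by apply: is_derive_eq; rewrite /GRing.scale/= !mulr1 !addr0 add0r; ring.
apply: is_derive_eq (is_deriveV _ dg) _; first by rewrite gt_eqF ?(den_gt0 (x, y)).
by rewrite /GRing.scale/= /qh /= exprVn; ring.
Qed.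

Lemma is_derive_qh1 z : is_derive z (basis2 1) qh (- (2 * z.2 * qh z ^+ 2)).
Proof.
apply/is_derive_basis1; case: z => x y /=.
have dg : is_derive y 1 (fun t : R => 1 + (x ^+ 2 + t ^+ 2)) (2 * y).
  by apply: is_derive_eq; rewrite /GRing.scale/= !mulr1 !add0r; ring.
apply: is_derive_eq (is_deriveV _ dg) _; first by rewrite gt_eqF ?(den_gt0 (x, y)).
by rewrite /GRing.scale/= /qh /= exprVn; ring.
Qed.

Lemma is_derive_hmap j i z : is_derive z (basis2 j) (component hmap i) (dh j i z).
Proof.
rewrite (_ : component hmap i =
  fun z => [:: (-2 * z.2) * qh z; (2 * z.1) * qh z; 1 - 2 * qh z]`_i); last first.
  by apply/funext => w; rewrite /component hmapE.
have [->|->] := ord2E j; rewrite /dh/=.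
- have /is_derive_basis0 dq := is_derive_qh0 z.
  apply/is_derive_basis0; case: z dq => x y /= dq.
  by case: (ord3E i) => -> /=; apply: is_derive_eq; rewrite /GRing.scale/=; ring.
- have /is_derive_basis1 dq := is_derive_qh1 z.
  apply/is_derive_basis1; case: z dq => x y /= dq.
  by case: (ord3E i) => -> /=; apply: is_derive_eq; rewrite /GRing.scale/=; ring.
Qed.

Definition coef a b j : R := if j == 0 then a else b.

Lemma is_derive_scale a b j (u : R * R -> R) z d :
  is_derive (scale a b z) (basis2 j) u d ->
  is_derive z (basis2 j) (u \o scale a b) (coef a b j * d).
Proof.
have dl (c t : R) : is_derive t 1 (fun t => c * t) c.
  by apply: is_derive_eq; rewrite /GRing.scale/= mulr1.
have [->|->] := ord2E j; rewrite /coef/= mulrC.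
  move=> /is_derive_basis0 du; apply/is_derive_basis0.
  exact: (@is_derive1_comp _ (fun t => u (t, b * z.2)) (fun t => a * t)).
move=> /is_derive_basis1 du; apply/is_derive_basis1.
exact: (@is_derive1_comp _ (fun t => u (a * z.1, t)) (fun t => b * t)).
Qed.

Definition dsk a b j i z : R := coef a b j * dh j i (scale a b z).

Lemma continuous_scale a b : continuous (scale a b).
Proof.
move=> z; have h1 : a * w.1 @[w --> z] --> a * z.1.
  by apply: cvgM; [exact: cvg_cst|exact: cvg_fst].
have h2 : b * w.2 @[w --> z] --> b * z.2.
  by apply: cvgM; [exact: cvg_cst|exact: cvg_snd].
exact: (cvg_pair (G := nbhs (a * z.1)) (H := nbhs (b * z.2)) h1 h2).
Qed.

Lemma continuous_sk a b i : continuous (component (sk a b) i).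
Proof.
move=> z; apply: (@continuous_comp _ _ _ (scale a b) (component hmap i)).
  exact: continuous_scale.
exact: continuous_hmap.
Qed.

Lemma continuous_dsk a b j i : continuous (dsk a b j i).
Proof.
move=> z; apply: cvgM; first exact: cvg_cst.
apply: (@continuous_comp _ _ _ (scale a b) (dh j i)).
  exact: continuous_scale.
exact: continuous_dh.
Qed.

Lemma is_derive_sk a b j i z :
  is_derive z (basis2 j) (component (sk a b) i) (dsk a b j i z).
Proof. exact: (is_derive_scale (is_derive_hmap j i (scale a b z))). Qed.

(** Conformality of h: both partial derivatives have the same length. *)
Lemma sum_dh j z : \sum_(i < 3) dh j i z ^+ 2 = 4 * qh z ^+ 2.
Proof.
have q0 := gt_eqF (den_gt0 z).
rewrite sum3 /dh; have [->|->] := ord2E j; rewrite /= /qh; field; by rewrite q0.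
Qed.

Lemma sum_dsk a b z :
  \sum_(j < 2) \sum_(i < 3) dsk a b j i z ^+ 2 =
  4 * (a ^+ 2 + b ^+ 2) * qh (scale a b z) ^+ 2.
Proof.
have E j : \sum_(i < 3) dsk a b j i z ^+ 2 =
    coef a b j ^+ 2 * (4 * qh (scale a b z) ^+ 2).
  by rewrite -(sum_dh j) mulr_sumr; apply: eq_bigr => i _; rewrite exprMn.
by rewrite sum2 !E /coef/=; ring.
Qed.

Lemma dot_sk_sub_e3 a b z : dot (sk a b z - e3) (sk a b z - e3) =
  4 * qh (scale a b z).
Proof.
rewrite /dot sum3 !rowB /sk; move: (scale a b z) => w.
rewrite !hmapE /e3 !vec3E/=; have q0 := gt_eqF (den_gt0 w).
by rewrite /qh; field; rewrite q0.
Qed.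

Lemma enorm_sk a b z : enorm (sk a b z) = 1.
Proof.
rewrite /enorm (_ : dot _ _ = 1) ?sqrtr1// /dot sum3 /sk.
move: (scale a b z) => w; rewrite !hmapE/=; have q0 := gt_eqF (den_gt0 w).
by rewrite /qh; field; rewrite q0.
Qed.

Lemma enorm4_sk a b z : enorm (sk a b z - e3) ^+ 4 = 16 * qh (scale a b z) ^+ 2.
Proof.
rewrite /enorm (_ : 4%N = (2 * 2)%N)// exprM sqr_sqrtr.
  by rewrite dot_sk_sub_e3 exprMn; ring.
by rewrite dot_sk_sub_e3 mulr_ge0// ltW ?qh_gt0.
Qed.

(** The terms of the density that are not rotationally symmetric cancel, so that
    only a + b matters even when a and b differ. *)
Lemma dot_curl_sk a b z :
  dot (sk a b z - e3) (vec3 (dsk a b 1 2 z) (- dsk a b 0 2 z)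
     (dsk a b 0 1 z - dsk a b 1 0 z)) =
  - (4 * (a + b)) * qh (scale a b z) ^+ 2.
Proof.
rewrite /dot sum3 !rowB /sk /dsk; move: (scale a b z) => w.
rewrite !hmapE /e3 !vec3E /coef /dh/=; have q0 := gt_eqF (den_gt0 w).
by rewrite /qh; field; rewrite q0.
Qed.

Lemma hscaledE (l : R) : hscaled l = sk l^-1 l^-1.
Proof.
apply/funext => z; rewrite /hscaled /sk /scale.
by rewrite [l^-1 * _]mulrC [l^-1 * z.2]mulrC.
Qed.

End skyrmion_calculus.

(** * The integral of the energy density *)

Section scaling.
Context {R : realType}.
Local Notation T2 := (measurableTypeR R * measurableTypeR R)%type.

Lemma integral_scale1 (G : R -> R) (c : R) : 0 < c -> continuous G ->
  (forall x, 0 <= G x) ->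
  (\int[lebesgue_measure]_x (G (c * x))%:E =
   c^-1%:E * \int[lebesgue_measure]_x (G x)%:E)%E.
Proof.
move=> c0 cG G0.
have dF (x : R) : is_derive x 1 (fun x => c * x) c.
  by apply: is_derive_eq; rewrite /GRing.scale/= mulr1.
have F'E : (fun x : R => c * x)^`()%classic = cst c.
  by apply/funext => x; rewrite derive1E derive_val.
rewrite (@increasing_ge0_integration_by_substitutionT _ (fun x => c * x) G)//.
- rewrite F'E; 
  have -> : (\int[lebesgue_measure]_x (((G \o (fun x => c * x)) * cst c) x)%:E =
      \int[lebesgue_measure]_x (c%:E * (G (c * x))%:E))%E.
    by apply: eq_integral => x _; rewrite -EFinM mulrC.
  rewrite ge0_integralZl//=.
  + by rewrite muleA -EFinM mulVf ?gt_eqF// mul1e.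
  + apply/measurable_EFinP/measurableT_comp; first exact: continuous_measurable_fun.
    by apply: continuous_measurable_fun; exact: is_derive_continuous dF.
  + by move=> x _; rewrite lee_fin.
  + by rewrite lee_fin ltW.
- by move=> x y xy; rewrite ltr_pM2l.
- by rewrite F'E; exact: cst_continuous.
- by rewrite F'E; exact: is_cvg_cst.
- by rewrite F'E; exact: is_cvg_cst.
- exact: gt0_cvgMrNy.
- exact: gt0_cvgMry.
Qed.

(** Tonelli's theorem allows stretching one coordinate at a time, each time as
    the inner integration variable. *)
Lemma integral_scale (f : R * R -> R) (a b : R) : 0 < a -> 0 < b ->
  continuous f -> (forall z, 0 <= f z) ->
  (\int[leb2]_z (f (scale a b z))%:E = (a * b)^-1%:E * \int[leb2]_z (f z)%:E)%E.
Proof.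
move=> a0 b0 cf f0.
have mS (u v : R) : measurable_fun [set: T2] (EFin \o (f \o scale u v)).
  apply/measurable_EFinP; apply: (@continuous_plane_measurable _ (f \o scale u v)) => z.
  by apply: (@continuous_comp _ _ _ (scale u v) f); [exact: continuous_scale|exact: cf].
have P (u v : R) (z : T2) : (0 <= (EFin \o (f \o scale u v)) z)%E.
  by rewrite lee_fin; exact: f0.
have S11 : scale 1 1 = @id (R * R).
  by apply/funext => -[x y]; rewrite /scale !mul1r.
have stepb : (\int[leb2]_z (f (scale a b z))%:E =
              b^-1%:E * \int[leb2]_z (f (scale a 1 z))%:E)%E.
  rewrite [LHS](fubini_tonelli1 _ (mS a b) (P a b)).
  rewrite [X in (_ * X)%E](fubini_tonelli1 _ (mS a 1) (P a 1)).
  rewrite -ge0_integralZl//.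
  - apply: eq_integral => x _; rewrite /fubini_F /scale /=.
    rewrite (integral_scale1 (G := fun t => f (a * x, t)) b0)//.
      by under [in RHS]eq_integral do rewrite mul1r.
    exact: continuous_slice1.
  - exact: measurable_fun_fubini_tonelli_F.
  - by move=> x _; apply: integral_ge0 => y _; exact: P.
  - by rewrite lee_fin invr_ge0 ltW.
have stepa : (\int[leb2]_z (f (scale a 1 z))%:E =
              a^-1%:E * \int[leb2]_z (f (scale 1 1 z))%:E)%E.
  rewrite [LHS](fubini_tonelli2 _ (mS a 1) (P a 1)).
  rewrite [X in (_ * X)%E](fubini_tonelli2 _ (mS 1 1) (P 1 1)).
  rewrite -ge0_integralZl//.
  - apply: eq_integral => y _; rewrite /fubini_G /scale /= mul1r.
    rewrite (integral_scale1 (G := fun t => f (t, y)) a0)//.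
      by under [in RHS]eq_integral do rewrite mul1r.
    exact: continuous_slice0.
  - exact: measurable_fun_fubini_tonelli_G.
  - by move=> x _; apply: integral_ge0 => y _; exact: P.
  - by rewrite lee_fin invr_ge0 ltW.
by rewrite stepb stepa S11 muleA -EFinM invfM mulrC.
Qed.

Lemma integral_oneDsqr_lty :
  (\int[lebesgue_measure]_x ((1 + x ^+ 2)^-1 : R)%:E < +oo)%E.
Proof.
rewrite (@ge0_symfun_integralT _ (fun x : R => (1 + x ^+ 2)^-1)).
- by rewrite -set_itvcy (@integral0y_oneDsqr R) -EFinM ltry.
- by move=> x; rewrite invr_ge0 addr_ge0// sqr_ge0.
- exact: continuous_oneDsqrV.
- by move=> x /=; rewrite sqrrN.
Qed.

(** The square of 1 + x^2 + y^2 dominates (1 + x^2)(1 + y^2), whose inverse has a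
    finite integral because arctan is bounded. *)
Lemma integral_qh2_lty : (\int[leb2]_z (qh z ^+ 2 : R)%:E < +oo)%E.
Proof.
pose g (x : R) := (1 + x ^+ 2)^-1.
have g0 x : 0 <= g x by rewrite invr_ge0 addr_ge0// sqr_ge0.
have cg : continuous g := @continuous_oneDsqrV R.
have mg : measurable_fun [set: T2] (fun z => (tensor g g z)%:E).
  apply/measurable_EFinP; apply: (@continuous_plane_measurable _ (tensor g g)).
  exact: tensor_continuous.
apply: (@le_lt_trans _ _ (\int[leb2]_z (tensor g g z)%:E)%E).
  apply: ge0_le_integral => //.
  - by move=> z _; rewrite lee_fin sqr_ge0.
  - by apply/measurable_EFinP; exact: (continuous_plane_measurable continuous_qh2).
  - move=> z _; rewrite lee_fin /tensor /g /qh exprVn -invfM.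
    rewrite lef_pV2 ?posrE ?exprn_gt0 ?mulr_gt0 ?den_gt0//.
    + have [X Y] : 0 <= z.1 ^+ 2 /\ 0 <= z.2 ^+ 2 by rewrite !sqr_ge0.
      move: X Y; move: (z.1 ^+ 2) (z.2 ^+ 2) => X Y X0 Y0.
      by rewrite expr2; nra.
    + by rewrite ltr_pwDl// sqr_ge0.
    + by rewrite ltr_pwDl// sqr_ge0.
rewrite (fubini_tonelli1 _ mg); last by move=> z; rewrite lee_fin mulr_ge0.
rewrite /fubini_F /tensor /=.
have mg1 : measurable_fun [set: measurableTypeR R] (fun x => (g x)%:E).
  by apply/measurable_EFinP; exact: continuous_measurable_fun.
have inner (x : R) : (\int[lebesgue_measure]_y (g x * g y)%:E =
    (g x)%:E * \int[lebesgue_measure]_y (g y)%:E)%E.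
  under eq_integral do rewrite EFinM.
  by rewrite ge0_integralZl// => [y _|]; rewrite lee_fin.
under eq_integral do rewrite inner.
have I0 : (0 <= \int[lebesgue_measure]_y (g y)%:E)%E.
  by apply: integral_ge0 => y _; rewrite lee_fin.
have Ilty : (\int[lebesgue_measure]_y (g y)%:E < +oo)%E := integral_oneDsqr_lty.
rewrite ge0_integralZr// => [|y _]; last by rewrite lee_fin.
by rewrite lte_mul_pinfty// ge0_fin_numE.
Qed.

Lemma integral_qh2_gt0 : (0 < \int[leb2]_z (qh z ^+ 2 : R)%:E)%E.
Proof.
have mq : measurable_fun [set: T2] (fun z => (qh z ^+ 2)%:E).
  by apply/measurable_EFinP; exact: (continuous_plane_measurable continuous_qh2).
have mB : measurable (box 1 : set T2).
  by apply: compact_plane_measurable; exact: box_compact.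
apply: (@lt_le_trans _ _ (\int[leb2]_(z in box 1) (9^-1)%:E)%E).
  rewrite integral_cst//; apply: mule_gt0; first by rewrite lte_fin.
  have -> : leb2 (box 1) =
    (@lebesgue_measure R `[(- 1)%R, 1%R] * @lebesgue_measure R `[(- 1)%R, 1%R])%E.
    by apply: product_measure1E; exact: measurable_itv.
  by rewrite !lebesgue_measure_itv/= lte_fin ifT; [rewrite -EFinM lte_fin|]; lra.
apply: (@le_trans _ _ (\int[leb2]_(z in box 1) (qh z ^+ 2)%:E)%E).
  apply: ge0_le_integral => //.
  - exact: measurable_funTS.
  - move=> [x y] [/= x1 y1]; rewrite lee_fin /qh /= exprVn.
    have sq1 (t : R) : t \in `[-1, 1] -> t ^+ 2 <= 1.
      by rewrite in_itv/= => /andP[? ?]; rewrite expr2; nra.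
    have X1 := sq1 _ x1; have Y1 := sq1 _ y1.
    have X0 := sqr_ge0 x; have Y0 := sqr_ge0 y.
    have d0 : 0 < 1 + (x ^+ 2 + y ^+ 2) by lra.
    rewrite lef_pV2 ?posrE//; last exact: exprn_gt0.
    have d3 : 1 + (x ^+ 2 + y ^+ 2) <= 3 by lra.
    by move: (1 + _) d0 d3 => d d0 d3; rewrite expr2; nra.
apply: ge0_subset_integral => //.
by move=> z _; rewrite lee_fin sqr_ge0.
Qed.

Lemma integral_skyrmion_density : exists2 J : R, 0 < J &
  forall a b, 0 < a -> 0 < b ->
    (\int[leb2]_z (qh (scale a b z) ^+ 2)%:E = (J / (a * b))%:E)%E.
Proof.
have fin : (\int[leb2]_z (qh z ^+ 2 : R)%:E)%E \is a fin_num.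
  by rewrite ge0_fin_numE ?integral_qh2_lty// ltW// integral_qh2_gt0.
exists (fine (\int[leb2]_z (qh z ^+ 2 : R)%:E)%E).
  by rewrite fine_gt0// integral_qh2_lty integral_qh2_gt0.
move=> a b a0 b0; rewrite (@integral_scale (fun z => qh z ^+ 2))//.
- by rewrite EFinM fineK// muleC.
- exact: continuous_qh2.
- by move=> z; exact: sqr_ge0.
Qed.

End scaling.

(** * Energies of continuously differentiable fields *)

Section C1_fields.
Context {R : realType}.
Local Notation T2 := (measurableTypeR R * measurableTypeR R)%type.
Implicit Types (n : R * R -> 'rV[R]_3) (dn : 'I_2 -> 'I_3 -> R * R -> R).

(** The derivatives are a parameter because the weak derivatives of the field are
    to be replaced by explicit formulas. *)
Definition C1_field n dn := [/\ forall i, continuous (component n i),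
  forall j i, continuous (dn j i) &
  forall j i x, is_derive x (basis2 j) (component n i) (dn j i x)].

Lemma C1_field_weak_partial n dn j i : C1_field n dn ->
  is_weak_partial j (component n i) (dn j i).
Proof. by move=> [cn cdn d]; apply: C1_weak_partial. Qed.

Lemma C1_field_weakly_differentiable n dn i : C1_field n dn ->
  weakly_differentiable (component n i).
Proof. by move=> dnP j; exists (dn j i); exact: C1_field_weak_partial. Qed.

(** The bridge between the energies, which are expressed by arbitrary
    representatives of the weak derivatives, and explicit formulas. *)
Lemma wd_ae n dn : C1_field n dn ->
  {ae leb2, forall x : T2, forall j i, wd n j i x = dn j i x}.
Proof.
move=> dnP; apply: filter_forall => j; apply: filter_forall => i.
exact: weak_partial_ae (C1_field_weak_partial j i dnP).
Qed.

Lemma wd_measurable n dn j i : C1_field n dn ->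
  measurable_fun [set: T2] (wd n j i).
Proof. by move=> /C1_field_weak_partial-/(_ j i)/weak_partial_measurable. Qed.

Lemma grad_norm_sqr n x :
  grad_norm n x ^+ 2 = \sum_(j < 2) \sum_(i < 3) wd n j i x ^+ 2.
Proof.
by rewrite sqr_sqrtr// sumr_ge0// => j _; rewrite sumr_ge0// => i _; exact: sqr_ge0.
Qed.

Lemma integral_grad_norm n dn : C1_field n dn ->
  (\int[leb2]_x (grad_norm n x ^+ 2)%:E =
   \int[leb2]_x (\sum_(j < 2) \sum_(i < 3) dn j i x ^+ 2)%:E)%E.
Proof.
move=> dnP; under eq_integral do rewrite grad_norm_sqr.
have mS (f : 'I_2 -> 'I_3 -> T2 -> R) :
    (forall j i, measurable_fun [set: T2] (f j i)) ->
    measurable_fun [set: T2] (fun x => (\sum_(j < 2) \sum_(i < 3) f j i x ^+ 2)%:E).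
  move=> mf; apply/measurable_EFinP; apply: measurable_sum => j.
  by apply: measurable_sum => i; apply: measurable_funX.
apply: ae_eq_integral => //.
- by apply: mS => j i; exact: wd_measurable dnP.
- by apply: mS => j i; apply: continuous_plane_measurable; case: dnP.
- apply: filterS (wd_ae dnP) => x E _; congr EFin.
  by apply: eq_bigr => j _; apply: eq_bigr => i _; rewrite E.
Qed.

Lemma helicity_C1 n dn : C1_field n dn ->
  helicity n = (\int[leb2]_x (dot (n x - e3)
     (vec3 (dn 1 2 x) (- dn 0 2 x) (dn 0 1 x - dn 1 0 x)))%:E)%E.
Proof.
move=> dnP; rewrite /helicity.
have mn i : measurable_fun [set: T2] (component n i).
  by apply: continuous_plane_measurable; case: dnP.
have mS (f : 'I_2 -> 'I_3 -> T2 -> R) :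
    (forall j i, measurable_fun [set: T2] (f j i)) ->
    measurable_fun [set: T2] (fun x : T2 => (dot (n x - e3)
     (vec3 (f 1 2 x) (- f 0 2 x) (f 0 1 x - f 1 0 x)))%:E).
  move=> mf; apply/measurable_EFinP.
  rewrite (_ : (fun x => _) = (fun x => (component n 0 x - e3 0 0) * f 1 2 x +
     (component n 1 x - e3 0 1) * (- f 0 2 x) +
     (component n 2 x - e3 0 2) * (f 0 1 x - f 1 0 x))); last first.
    by apply/funext => x; rewrite /dot sum3 !rowB !vec3E.
  have mne i : measurable_fun [set: T2] (fun x => component n i x - e3 0 i).
    by apply: measurable_funB.
  by apply: measurable_funD; [apply: measurable_funD|]; apply: measurable_funM => //;
    [exact: measurableT_comp|exact: measurable_funB].
apply: ae_eq_integral => //.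
- by apply: (mS (wd n)) => j i; exact: wd_measurable dnP.
- by apply: mS => j i; apply: continuous_plane_measurable; case: dnP.
- apply: filterS (wd_ae dnP) => x E _; congr EFin.
  by rewrite /curl !E.
Qed.

Lemma sk_C1 a b : C1_field (sk a b) (dsk a b).
Proof.
split; [exact: continuous_sk|exact: continuous_dsk|exact: is_derive_sk].
Qed.

Lemma sk_sub_C1 a b c d : C1_field (fun x => sk a b x - sk c d x)
  (fun j i x => dsk a b j i x - dsk c d j i x).
Proof.
have E i : component (fun x => sk a b x - sk c d x) i =
    (component (sk a b) i \- component (sk c d) i).
  by apply/funext => x; rewrite /component rowB.
split=> [i|j i|j i x]; rewrite ?E.
- by move=> x; apply: cvgB; exact: continuous_sk.
- by move=> x; apply: cvgB; exact: continuous_dsk.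
- by apply: is_deriveB; exact: is_derive_sk.
Qed.

End C1_fields.

Section skyrmion_energy.
Context {R : realType}.
Local Notation T2 := (measurableTypeR R * measurableTypeR R)%type.

Lemma qh2_measurable (a b : R) :
  measurable_fun [set: T2] (fun z => (qh (scale a b z) ^+ 2)%:E).
Proof.
apply/measurable_EFinP.
apply: (@continuous_plane_measurable _ (fun z => qh (scale a b z) ^+ 2)) => z.
apply: (@continuous_comp _ _ _ (scale a b) (fun w => qh w ^+ 2)).
  exact: continuous_scale.
exact: continuous_qh2.
Qed.

(** The same constant J serves the three terms: this is what makes the sign of an
    energy difference decidable without computing any integral. *)
Lemma skyrmion_energy_terms : exists2 J : R, 0 < J &
  forall a b, 0 < a -> 0 < b ->
  [/\ Dirichlet (sk a b) = (2 * (a ^+ 2 + b ^+ 2) * (J / (a * b)))%:E,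
      helicity (sk a b) = (- (4 * (a + b)) * (J / (a * b)))%:E &
      V4 (sk a b) = (2 * (J / (a * b)))%:E].
Proof.
have [J J0 HJ] := @integral_skyrmion_density R; exists J => // a b a0 b0.
have intZ (k : R) : (\int[leb2]_z (k * qh (scale a b z) ^+ 2)%:E =
    (k * (J / (a * b)))%:E)%E.
  under eq_integral do rewrite EFinM.
  rewrite integralZl//; last first.
    apply/integrableP; split; first exact: qh2_measurable.
    under eq_integral do rewrite gee0_abs ?lee_fin ?sqr_ge0//.
    by rewrite HJ// ltry.
  by rewrite HJ.
split.
- rewrite /Dirichlet (integral_grad_norm (sk_C1 a b)).
  under eq_integral do rewrite sum_dsk.
  by rewrite intZ -EFinM; congr EFin; field; rewrite !gt_eqF.
- rewrite (helicity_C1 (sk_C1 a b)).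
  by under eq_integral do rewrite dot_curl_sk; rewrite intZ.
- rewrite /V4; under eq_integral do rewrite enorm4_sk.
  by rewrite intZ -EFinM; congr EFin; field; rewrite !gt_eqF.
Qed.

End skyrmion_energy.

(** * Convergence of the stretched skyrmions and instability *)

Section convergence.
Context {R : realType}.
Local Notation T2 := (measurableTypeR R * measurableTypeR R)%type.
Implicit Types (z : R * R).

(** Stated with the p-th power of the bound, so that smallness of integrals of
    p-th powers gives smallness of norms without passing to the limit in roots. *)
Lemma Lnorm_lt (p : nat) (f : T2 -> R) (d : R) : (0 < p)%N -> 0 < d ->
  (forall x, 0 <= f x) -> (\int[leb2]_x (f x ^+ p)%:E < (d ^+ p)%:E)%E ->
  ('N[leb2]_(p%:R%:E)[EFin \o f] < d%:E)%E.
Proof.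
move=> p0 d0 f0 ltd; rewrite unlock.
have p0R : 0 < p%:R^-1 :> R by rewrite invr_gt0 ltr0n.
have -> : (\int[leb2]_x (`|(EFin \o f) x| `^ p%:R) = \int[leb2]_x (f x ^+ p)%:E)%E.
  apply: eq_integral => x _.
  by rewrite gee0_abs ?lee_fin ?f0//= powR_mulrn ?f0.
have I0 : (0 <= \int[leb2]_x (f x ^+ p)%:E)%E.
  by apply: integral_ge0 => x _; rewrite lee_fin exprn_ge0 ?f0.
have /fineK <- : (\int[leb2]_x (f x ^+ p)%:E)%E \is a fin_num.
  by rewrite ge0_fin_numE// (lt_trans ltd)// ltry.
rewrite poweR_EFin lte_fin.
have dE : d = (d ^+ p) `^ p%:R^-1.
  by rewrite -powR_mulrn ?ltW// -powRrM mulfV ?powRr1 ?ltW// pnatr_eq0 -lt0n.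
rewrite [ltRHS]dE; apply: gt0_ltr_powR => //.
- by rewrite nnegrE fine_ge0.
- by rewrite nnegrE exprn_ge0 ?ltW.
- by rewrite -lte_fin fineK// ge0_fin_numE// (lt_trans ltd)// ltry.
Qed.

Lemma dominated_integral_lt (F : nat -> T2 -> R) (Q : T2 -> R) (d : R) : 0 < d ->
  (forall k, measurable_fun [set: T2] (F k)) ->
  (forall z, F k z @[k --> \oo] --> 0) ->
  leb2.-integrable setT (EFin \o Q) ->
  (forall k z, `|F k z| <= Q z) ->
  \forall k \near \oo, (\int[leb2]_z (F k z)%:E < d%:E)%E.
Proof.
move=> d0 mF cF iQ FQ.
have [||||_ _] := @dominated_convergence _ T2 R leb2 setT measurableT
  (fun k z => (F k z)%:E) (cst 0%E) (EFin \o Q) _ _ _ iQ _.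
- by move=> k; exact/measurable_EFinP.
- exact: measurable_cst.
- by apply: aeW => z _; apply: cvg_EFin; [exact: nearW|exact: cF].
- by apply: aeW => z k _; rewrite lee_fin.
rewrite integral0 => /fine_cvgP[fin lim].
near=> k; have finF : (\int[leb2]_z (F k z)%:E)%E \is a fin_num by near: k.
by rewrite -(fineK finF) lte_fin; near: k; exact: cvgr_lt lim _ d0.
Unshelve. all: by end_near. Qed.

Section stretched_sequence.
Variable l : R.
Hypothesis l0 : 0 < l.

(** Starting at 1/2 keeps both factors 1 + eps and 1 - eps between 1/2 and 2, so
    that a single integrable function dominates the whole sequence. *)
Definition eps (k : nat) : R := k.+2%:R^-1.
Definition stretch k := (1 + eps k) * l.
Definition squeeze k := (1 - eps k) * l.

Lemma eps_itv k : 0 < eps k <= 2^-1.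
Proof. by rewrite invr_gt0 ltr0n/= lef_pV2 ?posrE ?ltr0n// ler_nat. Qed.

Lemma eps_cvg0 : eps k @[k --> \oo] --> (0 : R).
Proof.
by have := @cvg_harmonic R; rewrite -cvg_shiftS.
Qed.

Lemma eps_mul_itv k : 0 <= eps k * l <= l / 2.
Proof.
have /andP[e0 e1] := eps_itv k.
by apply/andP; split; [exact/ltW/mulr_gt0|rewrite [leRHS]mulrC ler_pM2r].
Qed.

Lemma stretch_itv k : l / 2 <= stretch k <= 2 * l.
Proof.
rewrite /stretch mulrDl mul1r; have /andP[h0 h1] := eps_mul_itv k.
by apply/andP; split; lra.
Qed.

Lemma squeeze_itv k : l / 2 <= squeeze k <= 2 * l.
Proof.
rewrite /squeeze mulrBl mul1r; have /andP[h0 h1] := eps_mul_itv k.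
by apply/andP; split; lra.
Qed.

Lemma stretch_cvg : stretch k @[k --> \oo] --> l.
Proof.
rewrite -[X in _ --> X]mul1r -[1 in X in _ --> X]addr0.
by apply: cvgM; [apply: cvgD; [exact: cvg_cst|exact: eps_cvg0]|exact: cvg_cst].
Qed.

Lemma squeeze_cvg : squeeze k @[k --> \oo] --> l.
Proof.
rewrite -[X in _ --> X]mul1r -[1 in X in _ --> X]subr0.
by apply: cvgM; [apply: cvgB; [exact: cvg_cst|exact: eps_cvg0]|exact: cvg_cst].
Qed.

Lemma scale_cvg z : scale (stretch k) (squeeze k) z @[k --> \oo] --> scale l l z.
Proof.
have h1 : stretch k * z.1 @[k --> \oo] --> l * z.1.
  by apply: cvgM; [exact: stretch_cvg|exact: cvg_cst].
have h2 : squeeze k * z.2 @[k --> \oo] --> l * z.2.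
  by apply: cvgM; [exact: squeeze_cvg|exact: cvg_cst].
exact: (cvg_pair (G := nbhs (l * z.1)) (H := nbhs (l * z.2)) h1 h2).
Qed.

Lemma sk_cvg i z :
  component (sk (stretch k) (squeeze k)) i z @[k --> \oo] --> component (sk l l) i z.
Proof. exact: (cvg_comp _ _ (@scale_cvg z) (@continuous_hmap R i (scale l l z))). Qed.

Lemma dsk_cvg j i z :
  dsk (stretch k) (squeeze k) j i z @[k --> \oo] --> dsk l l j i z.
Proof.
apply: cvgM.
  by rewrite /coef; case: ifP => _; [exact: stretch_cvg|exact: squeeze_cvg].
exact: (cvg_comp _ _ (@scale_cvg z) (@continuous_dh R j i (scale l l z))).
Qed.

Lemma qh_scale_le a b z : l / 2 <= a -> l / 2 <= b ->
  qh (scale a b z) <= qh (scale (l / 2) (l / 2) z).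
Proof.
have l20 : 0 <= l / 2 by rewrite divr_ge0 ?ltW.
have mono (c x : R) : l / 2 <= c -> (l / 2 * x) ^+ 2 <= (c * x) ^+ 2.
  move=> hc; rewrite [leLHS]exprMn [leRHS]exprMn.
  apply: ler_wpM2r; first exact: sqr_ge0.
  by rewrite [leLHS]expr2 [leRHS]expr2 ler_pM.
by move=> la lb; rewrite lef_pV2 ?posrE ?den_gt0// lerD2l /= lerD// mono.
Qed.

Let Q z := qh (scale (l / 2) (l / 2) z) ^+ 2.

Lemma integrable_Q (c : R) : leb2.-integrable setT (EFin \o (fun z => c * Q z)).
Proof.
have [J J0 HJ] := @integral_skyrmion_density R.
have -> : EFin \o (fun z => c * Q z) = (fun z : T2 => c%:E * (Q z)%:E)%E by [].
apply: integrableZl => //.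
apply/integrableP; split; first exact: qh2_measurable.
under eq_integral do rewrite gee0_abs ?lee_fin ?sqr_ge0//.
by rewrite HJ ?divr_gt0// ltry.
Qed.

Lemma qh2_le a b z : l / 2 <= a -> l / 2 <= b -> qh (scale a b z) ^+ 2 <= Q z.
Proof.
move=> la lb; have h := qh_scale_le z la lb.
by rewrite /Q [leLHS]expr2 [leRHS]expr2 ler_pM// ltW// qh_gt0.
Qed.

Lemma dot_subl (u v : 'rV[R]_3) :
  dot (u - v) (u - v) <= 2 * (dot (u - e3) (u - e3) + dot (v - e3) (v - e3)).
Proof.
rewrite /dot -big_split mulr_sumr; apply: ler_sum => i _ /=; rewrite !rowB.
by move: (u 0 i) (v 0 i) (e3 0 i) => x y e; have := sqr_ge0 (x + y - 2 * e); nra.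
Qed.

Lemma enorm4E (u : 'rV[R]_3) : enorm u ^+ 4 = dot u u ^+ 2.
Proof.
rewrite /enorm (_ : 4%N = (2 * 2)%N)// exprM sqr_sqrtr//.
by apply: sumr_ge0 => i _; rewrite -expr2 sqr_ge0.
Qed.

Lemma sk_L4_small (d : R) : 0 < d -> \forall k \near \oo,
  (\int[leb2]_z (enorm (sk (stretch k) (squeeze k) z - sk l l z) ^+ 4)%:E < d%:E)%E.
Proof.
move=> d0.
have cE k :
    continuous (fun z => enorm (sk (stretch k) (squeeze k) z - sk l l z) ^+ 4 : R).
  have [cc _ _] := sk_sub_C1 (stretch k) (squeeze k) l l.
  under eq_fun do rewrite enorm4E /dot sum3 -!expr2.
  move=> z; apply: cvg_sqr.
  by apply: cvgD; [apply: cvgD|]; apply: cvg_sqr; exact: cc.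
(* 256 = 16^2, as |u - v|^2 <= 2 |u - e_3|^2 + 2 |v - e_3|^2 <= 16 qh at l/2. *)
apply: (dominated_integral_lt d0 _ _ (integrable_Q 256)) => [k|z|k z].
- exact: continuous_plane_measurable.
- have cS i : sk (stretch k) (squeeze k) z 0 i @[k --> \oo] --> hmap (scale l l z) 0 i.
    exact: (@sk_cvg i z).
  under eq_fun do rewrite enorm4E /dot sum3 -!expr2 !rowB.
  have -> : (0 : R) = ((hmap (scale l l z) 0 0 - hmap (scale l l z) 0 0) ^+ 2 +
     (hmap (scale l l z) 0 1 - hmap (scale l l z) 0 1) ^+ 2 +
     (hmap (scale l l z) 0 2 - hmap (scale l l z) 0 2) ^+ 2) ^+ 2.
    by rewrite !subrr expr0n/= !addr0 expr0n.
  apply: cvg_sqr; apply: cvgD; [apply: cvgD|]; apply: cvg_sqr;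
    apply: cvgB; (exact: cS || exact: cvg_cst).
- rewrite ger0_norm ?exprn_ge0 ?sqrtr_ge0// enorm4E.
  have := dot_subl (sk (stretch k) (squeeze k) z) (sk l l z); rewrite !dot_sk_sub_e3.
  have /andP[la _] := stretch_itv k; have /andP[lb _] := squeeze_itv k.
  have ll : l / 2 <= l by have := l0; lra.
  have := qh_scale_le z la lb; have := qh_scale_le z ll ll; rewrite /Q.
  have := qh_gt0 (scale l l z); have := qh_gt0 (scale (stretch k) (squeeze k) z).
  have : 0 <= dot (sk (stretch k) (squeeze k) z - sk l l z)
                  (sk (stretch k) (squeeze k) z - sk l l z).
    by apply: sumr_ge0 => i _; rewrite -expr2 sqr_ge0.
  move: (dot _ _) (qh (scale (stretch k) _ _)) (qh (scale l _ _))
    (qh (scale (l / 2) _ _)) => D q1 q2 q3.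
  move=> D0 q10 q20 q23 q13 DD; have D16 : D <= 16 * q3 by lra.
  by rewrite (_ : 256 * q3 ^+ 2 = (16 * q3) * (16 * q3)); [rewrite expr2 ler_pM|ring].
Qed.

Lemma sk_grad_small (d : R) : 0 < d -> \forall k \near \oo,
  (\int[leb2]_z
     (grad_norm (fun z => sk (stretch k) (squeeze k) z - sk l l z)%R z ^+ 2)%:E
   < d%:E)%E.
Proof.
move=> d0.
under eq_near do rewrite (integral_grad_norm (sk_sub_C1 _ _ _ _)).
(* 80 = 2 * 4 * (4 + 4) + 2 * 4 * (1 + 1), as both factors are at most 2 l. *)
apply: (dominated_integral_lt d0 _ _ (integrable_Q (80 * l ^+ 2))) => [k|z|k z].
- apply: measurable_sum => j; apply: measurable_sum => i; apply: measurable_funX.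
  apply: continuous_plane_measurable.
  by have [] := sk_sub_C1 (stretch k) (squeeze k) l l.
- have cD j i : (dsk (stretch k) (squeeze k) j i z - dsk l l j i z) ^+ 2
      @[k --> \oo] --> (0 : R).
    rewrite -[X in _ --> X](expr0n _ 2) -(subrr (dsk l l j i z)).
    by apply: cvg_sqr; apply: cvgB; [exact: dsk_cvg|exact: cvg_cst].
  under eq_fun do rewrite sum2 !sum3.
  have -> : (0 : R) = (0 + 0 + 0) + (0 + 0 + 0) by rewrite !addr0.
  by apply: cvgD; apply: cvgD; (apply: cvgD || idtac); exact: cD.
- rewrite ger0_norm; last first.
    by apply: sumr_ge0 => j _; apply: sumr_ge0 => i _; exact: sqr_ge0.
  apply: (@le_trans _ _
      (2 * \sum_(j < 2) \sum_(i < 3) dsk (stretch k) (squeeze k) j i z ^+ 2 +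
       2 * \sum_(j < 2) \sum_(i < 3) dsk l l j i z ^+ 2)).
    rewrite !mulr_sumr -big_split; apply: ler_sum => j _ /=.
    rewrite !mulr_sumr -big_split; apply: ler_sum => i _ /=.
    move: (dsk _ _ _ _ _) (dsk l _ _ _ _) => x y.
    by have := sqr_ge0 (x + y); nra.
  rewrite !sum_dsk.
  have /andP[la al] := stretch_itv k; have /andP[lb bl] := squeeze_itv k.
  have ll : l / 2 <= l by have := l0; lra.
  have := qh2_le z la lb; have := qh2_le z ll ll.
  have := sqr_ge0 (qh (scale l l z)).
  have := sqr_ge0 (qh (scale (stretch k) (squeeze k) z)).
  move: (qh (scale (stretch k) _ _) ^+ 2) (qh (scale l _ _) ^+ 2) (Q z) => q1 q2 q3.
  move: (stretch k) (squeeze k) la al lb bl => a b la al lb bl q10 q20 q23 q13.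
  have a2 : a ^+ 2 <= 4 * l ^+ 2 by rewrite !expr2; nra.
  have b2 : b ^+ 2 <= 4 * l ^+ 2 by rewrite !expr2; nra.
  have l2 : 0 <= l ^+ 2 := sqr_ge0 l.
  by move: (a ^+ 2) (b ^+ 2) (l ^+ 2) a2 b2 l2 (sqr_ge0 a) (sqr_ge0 b) => A B L *; nra.
Qed.

Lemma dist4_sk_small (d : R) : 0 < d ->
  \forall k \near \oo, (dist4 (sk (stretch k) (squeeze k)) (sk l l) < d%:E)%E.
Proof.
move=> d0; have d2 : 0 < d / 2 by rewrite divr_gt0.
have := sk_L4_small (exprn_gt0 4 d2); have := sk_grad_small (exprn_gt0 2 d2).
apply: filterS2 => k hg h4.
rewrite /dist4 (_ : d%:E = (d / 2)%:E + (d / 2)%:E)%E; last by rewrite -EFinD -splitr.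

apply: lteD.
  by apply: (@Lnorm_lt 4 _ _ _ d2) => // x; exact: sqrtr_ge0.
by apply: (@Lnorm_lt 2 _ _ _ d2) => // x; exact: sqrtr_ge0.
Qed.

End stretched_sequence.

Lemma sk_M4 (a b : R) : 0 < a -> 0 < b -> M4 (sk a b).
Proof.
move=> a0 b0; have [J J0 HJ] := @skyrmion_energy_terms R.
have [D _ V] := HJ _ _ a0 b0; split.
- exact: enorm_sk.
- by move=> i; exact: C1_field_weakly_differentiable (sk_C1 a b).
- by rewrite D V -EFinD ltry.
Qed.

(** The excess has the sign of 1 - r^2: at r = 1 the energy is constant along the
    family, and the part of it that r amplifies decreases with e. *)
Lemma E4_sk_lt (r l e : R) : 1 < r -> l = (2 * r)^-1 -> 0 < e -> e < 1 ->
  (E4 r (sk ((1 + e) * l) ((1 - e) * l)) - E4 r (sk l l) < 0)%E.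
Proof.
move=> r1 lE e0 e1; have r0 : 0 < r by lra.
have l0 : 0 < l by rewrite lE invr_gt0 mulr_gt0.
have [J J0 HJ] := @skyrmion_energy_terms R.
have a0 : 0 < (1 + e) * l by rewrite mulr_gt0//; lra.
have b0 : 0 < (1 - e) * l by rewrite mulr_gt0//; lra.
rewrite /E4; have [-> -> ->] := HJ _ _ a0 b0; have [-> -> ->] := HJ _ _ l0 l0.
rewrite -!EFinM -!EFinD lte_fin.
rewrite [ltLHS](_ : _ = - (8 * e ^+ 2 * (r ^+ 2 - 1) * J / (1 - e ^+ 2))).
  rewrite oppr_lt0 divr_gt0//.
    by rewrite mulr_gt0// mulr_gt0 ?subr_gt0 ?exprn_egt1// mulr_gt0// exprn_gt0.
  by rewrite subr_gt0 exprn_ilt1// ltW.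
have e2 : 1 - e ^+ 2 != 0 by rewrite gt_eqF// subr_gt0 exprn_ilt1// ltW.
rewrite lE; field; rewrite e2 (gt_eqF r0) subr_eq0 (gt_eqF e1) gt_eqF //; lra.
Qed.

End convergence.

Theorem theorem1 (R : realType) (r : R) (hr : (1 < r)%R)
    (U : set (R * R -> 'rV[R]_3))
    (hU : M4_neighborhood (hscaled (2 * r)) U) :
  exists2 n, U n & (E4 r n - E4 r (hscaled (2 * r)) < 0)%E.
Proof.
rewrite hscaledE in hU *; set l := (2 * r)^-1 in hU *.
have l0 : 0 < l by rewrite invr_gt0 mulr_gt0// (lt_trans _ hr).
have [_ [e e0 HU]] := hU.
have [k _ /(_ k (leqnn k)) dk] := dist4_sk_small l0 e0.
have /andP[ek0 ek1] := @eps_itv R k.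
have /andP[la _] := stretch_itv l0 k; have /andP[lb _] := squeeze_itv l0 k.
exists (sk (stretch l k) (squeeze l k)).
  by apply: HU dk; apply: sk_M4; lra.
by apply: E4_sk_lt => //; lra.
Qed.
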